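(* Let $r\ge 1$ be an integer, let $\theta\in(0,\tfrac12)$ and let $\nu>0$ (with $\nu$ independent of $t$). Then for all sufficiently large $t>1$ (i.e. there is $t_0>1$ depending only on $r,\theta,\nu$ such that for all $t\ge t_0$) the following holds for the linear program $\mathbf{LW}_r(t)$ with feasible region $\mathcal F_t$. Let $\phi$ be a $\nu$-self-concordant barrier on $\mathcal F_t$ and let $\{x^k\}_{k\ge 0}$ be a sequence of iterates generated by a short-step method associated with $\phi$ (with neighbourhood parameter $\theta$), that is, $\bigcup_{k\ge0}[x^k,x^{k+1}]\subseteq \mathcal N^\phi_{\theta,t}$. Suppose that $$\mathsf{gap}(x^0)\ge 320\, r\,\nu\sqrt t\qquad\text{and}\qquad \mathsf{gap}(x^K)\le \frac{1}{180\,r}.$$ Then $K\ge 2^{r-3}$.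
   Context: For a real $t>1$ and an integer $r\ge1$, $\mathbf{LW}_r(t)$ is the linear program in $x\in\mathbb R^{2r}$: minimize $x_1$ subject to the $3r+1$ inequalities $x_1\le t^2$; $x_2\le t$; $x_{2j+1}\le t\,x_{2j-1}$, $x_{2j+1}\le t\,x_{2j}$ and $x_{2j+2}\le t^{1-1/2^j}(x_{2j-1}+x_{2j})$ for $j=1,\dots,r-1$; $x_{2r-1}\ge0$, $x_{2r}\ge 0$. Its feasible region is denoted $\mathcal F_t$ (a bounded polytope with non-empty interior $\mathcal F_t^\circ$), its cost vector is $c_t=(1,0,\dots,0)^\top$, and $\mathsf{gap}(x)=c_t^\top x-\min_{x'\in\mathcal F_t}c_t^\top x'$ for $x\in\mathcal F_t$. A self-concordant barrier on $\mathcal F_t$ is a three times continuously differentiable convex function $\phi:\mathcal F_t^\circ\to\mathbb R$ with $\phi(x)\to+\infty$ as $x\to\partial\mathcal F_t$ and $|D^3\phi(x)[h,h,h]|\le 2(D^2\phi(x)[h,h])^{3/2}$ for all $x\in\mathcal F_t^\circ$ and all vectors $h$. It is $\nu$-self-concordant if additionally $|D\phi(x)[h]|\le(\nu\,D^2\phi(x)[h,h])^{1/2}$ for all $x\in\mathcal F_t^\circ$ and all $h$. The Hessian $\nabla^2\phi(x)$ is positive definite at each $x\in\mathcal F_t^\circ$; write $\|h\|_x^*=\sqrt{h^\top(\nabla^2\phi(x))^{-1}h}$. For $\theta\in(0,1)$ and $\mu>0$ let $\mathcal N^\phi_{\theta,t}(\mu)=\{x\in\mathcal F_t^\circ:\|c_t+\mu\nabla\phi(x)\|_x^*\le\theta\mu\}$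 and $\mathcal N^\phi_{\theta,t}=\bigcup_{\mu>0}\mathcal N^\phi_{\theta,t}(\mu)$ (the $\ell_2$-neighbourhood). $[x,y]$ denotes the line segment between $x$ and $y$. A short-step method associated with $\phi$ is an algorithm generating iterates $\{x^k\}_{k\ge0}$ with $\bigcup_{k\ge0}[x^k,x^{k+1}]\subseteq\mathcal N^\phi_{\theta,t}$. *)

(* Defs.v *)
From HB Require Import structures.
From mathcomp Require Import all_boot all_order all_algebra.
From mathcomp Require Import all_classical all_reals all_analysis.
Set Implicit Arguments.
Unset Strict Implicit.
Unset Printing Implicit Defensive.
Import Order.TTheory GRing.Theory Num.Theory.
Import numFieldNormedType.Exports.
Local Open Scope classical_set_scope.
Local Open Scope ring_scope.

Section Calculus.
Variables (R : realType) (n : nat).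
Implicit Types (U D : set 'cV[R]_n) (f phi : 'cV[R]_n -> R) (x y h : 'cV[R]_n).

(* C^k on an open set U: f is Frechet differentiable on U and all its
   directional derivatives are C^(k-1) on U. Since n is finite, this is the
   same as the map x |-> Df(x) being C^(k-1). Functions on U are represented by
   total functions, whose values outside U are never used. *)
Fixpoint Ck_on (k : nat) U f : Prop :=
  if k is k'.+1 then
    (forall x, U x -> differentiable f x) /\
    (forall v : 'cV[R]_n, Ck_on k' U ('D_v f))
  else forall x, U x -> {for x, continuous f}.

(* D^k f(x)[h, ..., h] *)
Definition Dk (k : nat) f x h : R := iter k (fun g => 'D_h g) f x.

Definition unitvec (i : 'I_n) : 'cV[R]_n := delta_mx i 0.

Definition grad f x : 'cV[R]_n := \col_i 'D_(unitvec i) f x.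

Definition hess f x : 'M[R]_n :=
  \matrix_(i, j) 'D_(unitvec i) ('D_(unitvec j) f) x.

Definition boundary D : set 'cV[R]_n := closure D `\` D°.

(* For bounded D, divergence at each boundary point is the same, by
   compactness of the boundary, as divergence when the distance from x to the
   boundary tends to 0. *)
Record self_concordant_barrier D phi : Prop := {
  scb_C3 : Ck_on 3 D° phi;
  scb_convex : convex_function D° phi;
  scb_boundary : forall y, boundary D y ->
    phi x @[x --> within D° (nbhs y)] --> +oo;
  scb_concordant : forall x h, D° x ->
    `|Dk 3 phi x h| <= 2 * (Dk 2 phi x h) `^ (3 / 2)
}.

Definition nu_self_concordant_barrier (nu : R) D phi : Prop :=
  self_concordant_barrier D phi /\
  (forall x h, D° x -> `|Dk 1 phi x h| <= Num.sqrt (nu * Dk 2 phi x h)).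

(* The Hessian of a self-concordant barrier on a bounded set with non-empty
   interior is positive definite on the interior, so [invmx], which is the
   identity on singular matrices, is there the actual inverse. *)
Definition dual_norm phi x h : R :=
  Num.sqrt ((h^T *m invmx (hess phi x) *m h) 0 0).

Definition l2_nbhd_at (c : 'cV[R]_n) D phi (theta mu : R) : set 'cV[R]_n :=
  [set x | D° x /\ dual_norm phi x (c + mu *: grad phi x) <= theta * mu].

Definition l2_nbhd (c : 'cV[R]_n) D phi (theta : R) : set 'cV[R]_n :=
  \bigcup_(mu in [set mu : R | 0 < mu]) l2_nbhd_at c D phi theta mu.

Definition segment x y : set 'cV[R]_n :=
  [set (1 - s) *: x + s *: y | s in `[0 : R, 1]].

Definition short_step_iterates (c : 'cV[R]_n) D phi (theta : R)
    (x : nat -> 'cV[R]_n) : Prop :=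
  \bigcup_k segment (x k) (x k.+1) `<=` l2_nbhd c D phi theta.

End Calculus.

Section LongWinding.
Variables (R : realType) (r : nat) (t : R).
Implicit Types x : 'cV[R]_(2 * r).

(* The k-th coordinate of x, counted from 1; only used for 1 <= k <= 2r. *)
Definition coord1 x (k : nat) : R :=
  if insub k.-1 is Some i then x i 0 else 0.

Definition LW_feasible : set 'cV[R]_(2 * r) :=
  [set x | [/\ coord1 x 1 <= t ^+ 2,
               coord1 x 2 <= t,
               (forall j, (1 <= j < r)%N ->
                 [/\ coord1 x (2 * j + 1) <= t * coord1 x (2 * j - 1),
                     coord1 x (2 * j + 1) <= t * coord1 x (2 * j) &
                     coord1 x (2 * j + 2) <=
                       t `^ (1 - 1 / 2 ^+ j) *
                       (coord1 x (2 * j - 1) + coord1 x (2 * j))]),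
               0 <= coord1 x (2 * r - 1) &
               0 <= coord1 x (2 * r)]].

Definition LW_cost : 'cV[R]_(2 * r) := \col_i (i == 0%N :> nat)%:R.

Definition LW_value x : R := (LW_cost^T *m x) 0 0.

(* The infimum is attained, see [LW_infE] and [LW_min_attained]. *)
Definition LW_gap x : R := LW_value x - inf (LW_value @` LW_feasible).

End LongWinding.

Arguments LW_value {R r} x.
Arguments LW_feasible {R r} t.

Section LongWindingMin.
Variables (R : realType) (r : nat) (t : R).
Hypotheses (r_gt0 : (0 < r)%N) (t_gt1 : 1 < t).
Implicit Types x : 'cV[R]_(2 * r).

Lemma LW_valueE x : LW_value x = coord1 x 1.
Proof.
have h : (0 < 2 * r)%N by rewrite muln_gt0.
rewrite /LW_value /coord1 insubT /= mxE (bigD1 (Ordinal h)) //= !mxE eqxx mul1r.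
rewrite big1 ?addr0 // => i ne; rewrite !mxE.
by have /negPf-> : (i != 0 :> nat)%N; rewrite ?mul0r.
Qed.

Lemma coord1_0 k : coord1 (0 : 'cV[R]_(2 * r)) k = 0.
Proof. by rewrite /coord1; case: insub => // i; rewrite mxE. Qed.

Lemma LW_feasible0 : LW_feasible t (0 : 'cV[R]_(2 * r)).
Proof.
have t0 : 0 <= t by rewrite ltW // (lt_trans _ t_gt1).
rewrite /LW_feasible /=; split=> [||j _||]; rewrite ?coord1_0 ?exprn_ge0 //;
  by split; rewrite ?coord1_0 ?addr0 ?mulr0.
Qed.

Lemma LW_value_ge0 x : LW_feasible t x -> 0 <= LW_value x.
Proof.
move=> [_ _ H x0 _]; rewrite LW_valueE.
have t0 : 0 < t by rewrite (lt_trans _ t_gt1).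
suff P k : (k < r)%N -> 0 <= coord1 x (2 * (r - k) - 1).
  have /P : (r.-1 < r)%N by rewrite ltn_predL.
  by have -> : (r - r.-1 = 1)%N by rewrite -subn1 subKn.
elim: k => [|k IH] kr; first by rewrite subn0.
have /H[+ _ _] : (1 <= r - k.+1 < r)%N by rewrite subn_gt0 kr /= ltn_subrL.
move=> le; rewrite -(pmulr_rge0 _ t0) (le_trans _ le) //.
have -> : (2 * (r - k.+1) + 1 = 2 * (r - k) - 1)%N.
  by rewrite subnS -[in RHS](@prednK (r - k)) ?subn_gt0 1?ltnW //
    mulnS subn1 addn1.
by apply: IH; apply: ltnW.
Qed.

Lemma LW_infE : inf (LW_value @` (LW_feasible t : set 'cV[R]_(2 * r))) = 0.
Proof.
have v0 : LW_value (0 : 'cV[R]_(2 * r)) = 0 by rewrite LW_valueE coord1_0.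
apply/eqP; rewrite eq_le; apply/andP; split.
  apply: ge_inf; last by exists 0 => //; exact: LW_feasible0.
  by exists 0 => _ [x Fx <-]; exact: LW_value_ge0.
apply: lb_le_inf; first by exists 0, 0 => //; exact: LW_feasible0.
by move=> _ [x Fx <-]; exact: LW_value_ge0.
Qed.

Lemma LW_min_attained : exists2 x0, LW_feasible t x0 &
  LW_value (x0 : 'cV[R]_(2 * r)) = inf (LW_value @` (LW_feasible t : set 'cV[R]_(2 * r))).
Proof.
by exists 0; [exact: LW_feasible0|rewrite LW_infE LW_valueE coord1_0].
Qed.

End LongWindingMin.

(* Main.v *)
(** For a point [w] of the l2-neighbourhood and a feasible [y] whose cost is not
    larger, the restriction of the barrier to the line [w y] shows that [y] is
    at local distance at most [3 + 4 nu] from [w], while the open unit (Dikin)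
    ball at [w] is feasible. Hence every nonnegative coordinate of [w] is, up to
    the factor [5 + 4 nu], at least that of [y]: with [coord1 w 1 = t `^ l], the
    last two coordinates of [w] are within constant factors of the largest
    values they take on the sublevel set of the cost. In base-[t] logarithms
    these maxima follow a staircase in [l] with [2 ^ (r - 3)] steps on
    [0 <= l <= 1 / 2]. For large [t] an affine segment cannot contain points
    above the midpoints of two consecutive steps: at the corner in between, the
    coordinate that has already grown would be an average giving weight about
    [t `^ (- 2 ^- r.-1)] to the larger endpoint, which is too small. So each
    step needs its own iteration. *)

Require Import Defs.
From mathcomp Require Import all_boot all_order all_algebra.
From mathcomp Require Import all_classical all_reals all_analysis.
From mathcomp Require Import ring lra zify.
Import Order.TTheory GRing.Theory Num.Theory.
Import numFieldNormedType.Exports.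
Local Open Scope classical_set_scope.
Local Open Scope ring_scope.
Set Implicit Arguments.
Unset Strict Implicit.
Unset Printing Implicit Defensive.

(** * The self-concordance inequality on a real interval *)

Section SelfConcordantLine.
Context {R : realType}.
Implicit Types (f df : R -> R) (a b s eps : R).

Lemma MVT_is_derive f df a b : a <= b ->
  (forall s, a <= s <= b -> is_derive s 1 f (df s)) ->
  exists2 s, a <= s <= b & f b - f a = df s * (b - a).
Proof.
move=> ab fdf; have [||c cab E] := @MVT_segment R f df a b ab.
- by move=> s; rewrite in_itv /= => /andP[/ltW as_ /ltW sb]; apply/fdf/andP.
- apply: derivable_within_continuous => s; rewrite in_itv /= => sab.
  exact: (@ex_derive _ _ _ _ _ _ _ (fdf s sab)).
by exists c => //; move: cab; rewrite in_itv.
Qed.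

Lemma le_is_derive f df a b : a <= b ->
  (forall s, a <= s <= b -> is_derive s 1 f (df s)) ->
  (forall s, a <= s <= b -> 0 <= df s) -> f a <= f b.
Proof.
move=> ab fdf df0; have [s sab E] := MVT_is_derive ab fdf.
by rewrite -subr_ge0 E mulr_ge0 ?subr_ge0// df0.
Qed.

Lemma powR32 a : 0 <= a -> a `^ (3 / 2) = a * Num.sqrt a.
Proof.
move=> a0; have -> : 3 / 2 = 1 + 2^-1 :> R by lra.
rewrite powRD; last by apply/implyP => /eqP; lra.
by rewrite powRr1// powR12_sqrt.
Qed.

Variables (f df : R -> R) (b : R).
Hypotheses (fdf : forall s, 0 <= s <= b -> is_derive s 1 f (df s))
  (f_ge0 : forall s, 0 <= s <= b -> 0 <= f s)
  (f_sc : forall s, 0 <= s <= b -> `|df s| <= 2 * (f s) `^ (3 / 2)).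

(* [f] may vanish, so [1 / sqrt f] is replaced by [1 / sqrt (f + eps)]. *)
Lemma is_derive_invsqrt eps s : 0 < eps -> 0 <= s <= b ->
  is_derive s 1 (fun u => (Num.sqrt (f u + eps))^-1)
    (- (Num.sqrt (f s + eps)) ^- 3 / 2 * df s).
Proof.
move=> eps0 sb; have fe : 0 < f s + eps by rewrite ltr_wpDl// f_ge0.
have dfe : is_derive s 1 (fun u => f u + eps) (df s).
  rewrite -[X in is_derive _ _ _ X]addr0.
  exact: is_deriveD (fdf sb) (is_derive_cst eps s 1).
have dq := @is_derive1_comp R Num.sqrt (fun u => f u + eps) s _ _
  (is_derive1_sqrt fe) dfe.
have q0 : Num.sqrt (f s + eps) != 0 by rewrite gt_eqF// sqrtr_gt0.
have H := @is_deriveV R (Num.sqrt \o (fun u => f u + eps)) s _ 1 q0 dq.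
apply: (is_derive_eq H).
rewrite /= /GRing.scale /=; field; exact: q0.
Qed.

Lemma invsqrt_lipschitz eps s : 0 < eps -> 0 <= s <= b ->
  `|(Num.sqrt (f s + eps))^-1 - (Num.sqrt (f 0 + eps))^-1| <= s.
Proof.
move=> eps0 /andP[s0 sb].
set F := fun u => (Num.sqrt (f u + eps))^-1.
pose dF u := - (Num.sqrt (f u + eps)) ^- 3 / 2 * df u.
have sub u : 0 <= u <= s -> 0 <= u <= b.
  by move=> /andP[-> us] /=; exact: le_trans sb.
have dF1 u : 0 <= u <= s -> `|dF u| <= 1.
  move=> /sub ub; have fu := f_ge0 ub.
  have fe : 0 < f u + eps by rewrite ltr_wpDl.
  have q0 : 0 < Num.sqrt (f u + eps) by rewrite sqrtr_gt0.
  have q2 : Num.sqrt (f u + eps) ^+ 2 = f u + eps by rewrite sqr_sqrtr// ltW.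
  have -> : dF u = - (df u / (2 * Num.sqrt (f u + eps) ^+ 3)).
    by rewrite /dF; field; rewrite gt_eqF.
  have q3 : 0 < 2 * Num.sqrt (f u + eps) ^+ 3 by rewrite mulr_gt0// exprn_gt0.
  rewrite normrN normrM normfV (gtr0_norm q3) ler_pdivrMr// mul1r.
  rewrite (le_trans (f_sc ub))// ler_pM2l// powR32//.
  by rewrite exprSr q2 ler_pM ?sqrtr_ge0// ?ler_wsqrtr// lerDl ltW.
have up : F s - s <= F 0 - 0.
  rewrite -lerN2; 
  apply: (@le_is_derive (fun u => - (F u - u)) (fun u => - (dF u - 1))) => // v vs.
    apply: is_deriveN; apply: is_deriveB; exact: is_derive_invsqrt (sub _ vs).
  by have := dF1 _ vs; rewrite ler_norml; lra.
have down : F 0 + 0 <= F s + s.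
  apply: (@le_is_derive (fun u => F u + u) (fun u => dF u + 1)) => // v vs.
    apply: is_deriveD; exact: is_derive_invsqrt (sub _ vs).
  by have := dF1 _ vs; rewrite ler_norml; lra.
by rewrite -/(F s) -/(F 0) ler_norml; lra.
Qed.

End SelfConcordantLine.

(** * Growth of the second derivative, and how long a line can stay in the domain *)

Section SelfConcordantBounds.
Context {R : realType}.
Implicit Types (f df g : R -> R) (a b s sigma nu theta : R).

(* [M] is independent of [b], which will approach the exit time of a line. *)
Lemma concordant_upper sigma a : 0 <= sigma -> 0 <= a -> a * Num.sqrt sigma < 1 ->
  exists M, forall f df b,
    (forall s, 0 <= s <= b -> is_derive s 1 f (df s)) ->
    (forall s, 0 <= s <= b -> 0 <= f s) ->
    (forall s, 0 <= s <= b -> `|df s| <= 2 * (f s) `^ (3 / 2)) ->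
    f 0 = sigma -> 0 <= b <= a -> f b <= M.
Proof.
move=> sigma0 a0 asigma.
have a2 : a ^+ 2 * sigma < 1.
  by rewrite -(sqr_sqrtr sigma0) -exprMn expr_lt1// mulr_ge0 ?sqrtr_ge0.
(* Small enough to keep [a] below [c], the inverse square root of [sigma + eps]; the Lipschitz bound
   then keeps the inverse square root of [f b + eps] above [c - a]. *)
pose eps := (1 - a ^+ 2 * sigma) / (2 * (a ^+ 2 + 1)).
have a21 : 0 < a ^+ 2 + 1 by rewrite ltr_wpDl// exprn_ge0.
have eps0 : 0 < eps by rewrite divr_gt0 ?mulr_gt0// subr_gt0.
have aeps : a ^+ 2 * (sigma + eps) < 1.
  have : eps * (2 * (a ^+ 2 + 1)) = 1 - a ^+ 2 * sigma.
    by rewrite /eps mulfVK// gt_eqF// mulr_gt0.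
  have := sqr_ge0 a; nra.
have se0 : 0 < sigma + eps by rewrite ltr_wpDl.
have q0 : 0 < Num.sqrt (sigma + eps) by rewrite sqrtr_gt0.
pose c := (Num.sqrt (sigma + eps))^-1.
have ac : a < c.
  rewrite /c -div1r ltr_pdivlMr//.
  have aq0 : 0 <= a * Num.sqrt (sigma + eps) by rewrite mulr_ge0// ltW.
  by rewrite -(@ltr_pXn2r _ 2) ?nnegrE// exprMn sqr_sqrtr ?expr1n// ltW.
exists ((c - a) ^- 2); move=> f df b fdf f_ge0 f_sc f0 /andP[b0 ba].
have bb : 0 <= b <= b by rewrite b0 lexx.
have fe0 : 0 < f b + eps by rewrite ltr_wpDl// f_ge0.
have qb0 : 0 < Num.sqrt (f b + eps) by rewrite sqrtr_gt0.
have := invsqrt_lipschitz fdf f_ge0 f_sc eps0 bb.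
rewrite f0 -/c ler_norml => /andP[lo _].
have ca : 0 < c - a by rewrite subr_gt0.
have : c - a <= (Num.sqrt (f b + eps))^-1 by lra.
rewrite -[X in X <= _]invrK lef_pV2 ?posrE ?invr_gt0// => le.
apply: (@le_trans _ _ (f b + eps)); first by rewrite lerDl ltW.
by rewrite -(sqr_sqrtr (ltW fe0)) -exprVn ler_pXn2r// nnegrE ltW// invr_gt0.
Qed.

(** The Lipschitz bound gives [1 / sqrt (f b + eps) <= 1 / sqrt (f 0) + b] for every positive [eps];
    then [eps] tends to 0. *)
Lemma concordant_lower f df b :
    (forall s, 0 <= s <= b -> is_derive s 1 f (df s)) ->
    (forall s, 0 <= s <= b -> 0 <= f s) ->
    (forall s, 0 <= s <= b -> `|df s| <= 2 * (f s) `^ (3 / 2)) ->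
  0 <= b -> 0 < f 0 -> f 0 / (1 + Num.sqrt (f 0) * b) ^+ 2 <= f b.
Proof.
move=> fdf f_ge0 f_sc b0 f0; have bb : 0 <= b <= b by rewrite b0 lexx.
set q := Num.sqrt (f 0); have q0 : 0 < q by rewrite sqrtr_gt0.
have d0 : 0 < 1 + q * b by rewrite ltr_pwDl// mulr_ge0// ltW.
apply/ler_addgt0Pr => eps eps0.
have fe0 : 0 < f b + eps by rewrite ltr_wpDl// f_ge0.
have qb0 : 0 < Num.sqrt (f b + eps) by rewrite sqrtr_gt0.
have := invsqrt_lipschitz fdf f_ge0 f_sc eps0 bb.
rewrite ler_norml => /andP[_ up].
have qe : (Num.sqrt (f 0 + eps))^-1 <= q^-1.
  by rewrite lef_pV2 ?posrE ?sqrtr_gt0 ?addr_gt0// ler_wsqrtr// lerDl ltW.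
have : (Num.sqrt (f b + eps))^-1 <= (q / (1 + q * b))^-1.
  rewrite invf_div mulrDl mul1r mulrAC divff ?mul1r ?gt_eqF//; lra.
rewrite lef_pV2 ?posrE ?divr_gt0// => le.
rewrite -(sqr_sqrtr (ltW f0)) -/q -expr_div_n -(sqr_sqrtr (ltW fe0)).
by rewrite ler_pXn2r// ?nnegrE ?ltW ?divr_gt0.
Qed.

Lemma is_derive_mull (c s : R) : is_derive s 1 ( *%R c) c.
Proof.
rewrite -[X in is_derive _ _ _ X]mulr1.
exact: (is_deriveZ c (is_derive_id s (1 : R))).
Qed.

Variables (g f df : R -> R) (nu theta : R).
Hypotheses (gdf : forall s, 0 <= s < 1 -> is_derive s 1 g (f s))
  (fdf : forall s, 0 <= s < 1 -> is_derive s 1 f (df s))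
  (f_ge0 : forall s, 0 <= s < 1 -> 0 <= f s)
  (f_sc : forall s, 0 <= s < 1 -> `|df s| <= 2 * (f s) `^ (3 / 2))
  (g_nu : forall s, 0 <= s < 1 -> `|g s| <= Num.sqrt (nu * f s)).

(* At [s0 = 3 / sqrt sigma] the slope [g] is at least
   [sqrt sigma * (3 / 4 - theta)]; from there on [1 / g + s / nu] decreases, so
   that [g] blows up within [nu / g s0]. *)
Lemma concordant_length sigma : 0 < nu -> theta < 1 / 2 -> f 0 = sigma ->
  - theta * Num.sqrt sigma <= g 0 -> Num.sqrt sigma <= 3 + 4 * nu.
Proof.
move=> + + <-; set q := Num.sqrt (f 0) => nu0 theta2 g0.
rewrite leNgt; apply/negP => qnu.
have q3 : 3 < q by lra.
have q0 : 0 < q by lra.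
have f0 : 0 < f 0 by rewrite -sqrtr_gt0.
(* Once [g s0 >= q / 4], blow-up occurs no later than [s0 + 4 * nu / q = (4 * nu + 3) / q]; [s1] is
   the midpoint between that time and 1. *)
pose s0 := 3 / q; pose s1 := ((4 * nu + 3) / q + 1) / 2.
have s00 : 0 < s0 by rewrite divr_gt0.
have qs0 : q * s0 = 3 by rewrite /s0 mulrC divfK// gt_eqF.
have r1 : (4 * nu + 3) / q < 1 by rewrite ltr_pdivrMr//; lra.
have s0r : s0 <= (4 * nu + 3) / q by rewrite ler_pM2r ?invr_gt0//; lra.
have s11 : s1 < 1 by rewrite /s1; lra.
have s01 : s0 <= s1 by rewrite /s1; lra.
have g_s0 : q / 4 <= g s0.
  (* [- k] is a primitive of the lower bound on [f], so [g + k] increases; as [k] falls from [q] to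
     [q / 4], [g] gains at least [3 * q / 4]. *)
  pose k s := q * (1 + q * s)^-1.
  have : g 0 + k 0 <= g s0 + k s0.
    apply: (@le_is_derive _ (fun s => g s + k s)
      (fun s => f s - f 0 / (1 + q * s) ^+ 2)); first exact: ltW.
      move=> s /andP[s_ge0 ss0].
      have d0 : 1 + q * s != 0 by rewrite gt_eqF// ltr_pwDl// mulr_ge0// ltW.
      have sI : 0 <= s < 1 by rewrite s_ge0; lra.
      apply: is_deriveD; first exact: gdf.
      have dl : is_derive s 1 (fun s => 1 + q * s) q.
        have d1 : is_derive s 1 (cst 1 : R -> R) 0 by exact: is_derive_cst.
        have d2 : is_derive s 1 ( *%R q) q by exact: is_derive_mull.
        by rewrite -[X in is_derive _ _ _ X]add0r; exact: is_deriveD d1 d2.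
      have H := is_deriveZ q (@is_deriveV R (fun s => 1 + q * s) s _ _ d0 dl).
      apply: (is_derive_eq H); rewrite /GRing.scale /= -(sqr_sqrtr (ltW f0)) -/q.
      by field.
    move=> s /andP[s_ge0 ss0]; rewrite subr_ge0.
    apply: (@concordant_lower f df s) => //.
    - by move=> u /andP[u0 us]; apply: fdf; rewrite u0; lra.
    - by move=> u /andP[u0 us]; apply: f_ge0; rewrite u0; lra.
    - by move=> u /andP[u0 us]; apply: f_sc; rewrite u0; lra.
  rewrite /k qs0 mulr0 addr0 invr1 mulr1.
  have : theta * q <= q / 2 by nra.
  have -> : q / (1 + 3) = q / 4 by congr (_ / _); lra.
  lra.
have g_gt0 s : s0 <= s <= s1 -> 0 < g s.
  move=> /andP[ss0 ss1]; have : g s0 <= g s.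
    apply: (@le_is_derive _ g f) => // u /andP[u0 us].
      by apply: gdf; apply/andP; split; lra.
    by apply: f_ge0; apply/andP; split; lra.
  lra.
(* The derivative [f / g ^ 2 - 1 / nu] is nonnegative because [g ^ 2 <= nu * f]. *)
have : - ((g s0)^-1 + nu^-1 * s0) <= - ((g s1)^-1 + nu^-1 * s1).
  apply: (@le_is_derive _ (fun s => - ((g s)^-1 + nu^-1 * s))
      (fun s => - ((- (g s) ^- 2) * f s + nu^-1))) => //.
    move=> s sI; have gn0 : g s != 0 by rewrite gt_eqF// g_gt0.
    have sI' : 0 <= s < 1 by apply/andP; split; lra.
    apply: is_deriveN; apply: is_deriveD; first exact: is_deriveV (gdf sI').
    exact: is_derive_mull.
  move=> s sI; have gs0 := g_gt0 _ sI.
  have sI' : 0 <= s < 1 by apply/andP; split; lra.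
  have : g s ^+ 2 <= nu * f s.
    have nuf : 0 <= nu * f s by rewrite mulr_ge0 ?f_ge0// ltW.
    rewrite -[leRHS](sqr_sqrtr nuf) ler_pXn2r ?nnegrE ?sqrtr_ge0//; last exact: ltW.
    by have := g_nu sI'; rewrite (gtr0_norm gs0).
  rewrite mulNr opprD opprK subr_ge0 => le.
  by rewrite ler_pdivlMl ?exprn_gt0// ler_pdivrMr// mulrC.
have gs1 : 0 < (g s1)^-1 by rewrite invr_gt0 g_gt0// s01 lexx.
have gs0 : (g s0)^-1 <= 4 / q.
  by rewrite -[4 / q]invf_div lef_pV2 ?posrE ?divr_gt0 ?g_gt0// lexx s01.
rewrite lerN2 => le.
have : nu^-1 * s1 <= 4 / q + nu^-1 * s0 by lra.
rewrite -(ler_pM2l nu0) mulrDr !mulrA divff ?gt_eqF// !mul1r.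
have : (4 * nu + 3) / q = nu * 4 / q + s0 by rewrite /s0; field; rewrite gt_eqF.
rewrite /s1; lra.
Qed.

End SelfConcordantBounds.

(** * Restriction of a function to a line *)

Section LineCalculus.
Context {R : realType} {V : normedModType R}.
Implicit Types (phi : V -> R) (w h : V) (s : R).

Lemma is_derive_line phi w h s : differentiable phi (w + s *: h) ->
  is_derive s 1 (fun u => phi (w + u *: h)) ('D_h phi (w + s *: h)).
Proof.
move=> /(diff_derivable (v := h)) dphi.
have E : (fun u : R => u^-1 *: (((fun u => phi (w + u *: h)) \o shift s) (u *: 1) -
      phi (w + s *: h))) =
    (fun u : R => u^-1 *: ((phi \o shift (w + s *: h)) (u *: h) - phi (w + s *: h))).
  apply/funext => u /=; congr (_ *: (phi _ - _)).
  by rewrite [u *: 1]mulr1 scalerDl addrCA addrA.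
split; first by rewrite /derivable E.
by rewrite /derive E.
Qed.

Lemma nbhs_line w h s (B : set V) : nbhs (w + s *: h) B ->
  exists2 e, 0 < e & forall u, `|u - s| < e -> B (w + u *: h).
Proof.
move=> nB; have c : {for s, continuous (fun u : R => w + u *: h)}.
  by apply: cvgD; [exact: cvg_cst|apply: cvgZr_tmp; exact: cvg_id].
have /nbhs_ballP[e /= e0 eB] := c _ nB.
by exists e => // u ue; apply: eB; rewrite /ball /= distrC.
Qed.

End LineCalculus.

(** * Barriers along lines and the Dikin ball *)

Section Barrier.
Context {R : realType} {n : nat}.
Implicit Types (D U : set 'cV[R]_n) (phi : 'cV[R]_n -> R) (w x y h : 'cV[R]_n).

Lemma scb_differentiable D phi : self_concordant_barrier D phi ->
  forall x u v, D° x -> [/\ differentiable phi x, differentiable ('D_u phi) x &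
    differentiable ('D_u ('D_v phi)) x].
Proof.
move=> [[d0 C2] _ _ _] x u v Dx; split; first exact: d0.
  by have [] := C2 u => + _; apply.
by have [_ /(_ u)[+ _]] := C2 v; apply.
Qed.

(* Where [Dk 2] is negative, [Num.sqrt (nu * Dk 2)] is [0], so [Dk 1] vanishes
   there and so does its derivative [Dk 2]. *)
Lemma Dk2_ge0 nu D phi x h : 0 <= nu ->
  nu_self_concordant_barrier nu D phi ->
  D° x -> 0 <= Dk 2 phi x h.
Proof.
move=> nu0 [scb nub] Dx; rewrite leNgt; apply/negP => D2.
have [_ _ dD2] := scb_differentiable scb h h Dx.
have near_lt : \forall y \near x, Dk 2 phi y h < 0.
  exact: (cvgr_lt _ (differentiable_continuous dD2)).
suff : Dk 2 phi x h = 0 by move: D2 => /lt_eqF/eqP.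
rewrite /Dk /= -[RHS](derive_cst (0 : R) x h); apply: near_eq_derive.
near=> y; have Dy : D° y by near: y; exact: nbhs_interior.
have D2y : Dk 2 phi y h < 0 by near: y.
have := nub y h Dy; rewrite ler0_sqrtr ?normr_le0 => [/eqP//|].
exact: mulr_ge0_le0 nu0 (ltW D2y).
Unshelve. all: by end_near. Qed.

Lemma Dk_line D phi w h s : self_concordant_barrier D phi -> D° (w + s *: h) ->
  [/\ is_derive s 1 (fun u => phi (w + u *: h)) (Dk 1 phi (w + s *: h) h),
      is_derive s 1 (fun u => Dk 1 phi (w + u *: h) h) (Dk 2 phi (w + s *: h) h) &
      is_derive s 1 (fun u => Dk 2 phi (w + u *: h) h) (Dk 3 phi (w + s *: h) h)].
Proof.
move=> scb Dw; have [d0 d1 d2] := scb_differentiable scb h h Dw.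
by split; exact: is_derive_line.
Qed.

(** If the ray left the interior before time [a], the second derivative would stay bounded up to the
    exit time, hence so would [phi], against its divergence at the boundary. *)
Lemma dikin_interior nu D phi w h a : 0 <= nu -> nu_self_concordant_barrier nu D phi ->
  D° w -> 0 <= a -> a * Num.sqrt (Dk 2 phi w h) < 1 -> D° (w + a *: h).
Proof.
move=> nu0 nscb Dw a0 aD; have scb := nscb.1.
have f0 := Dk2_ge0 h nu0 nscb Dw.
have [M HM] := concordant_upper f0 a0 aD.
(* The supremum [T] of [S] is the exit time, capped at [a]. If the point at time [T] is interior,
   openness forces [T = a]; otherwise it is a boundary point. *)
pose S := [set s | 0 <= s <= a /\ forall u, 0 <= u <= s -> D° (w + u *: h)].
have S0 : S 0.
  split=> [|u]; first by rewrite lexx.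
  by rewrite -eq_le => /eqP <-; rewrite scale0r addr0.
have supS : has_sup S by split; [exists 0 | exists a => s [/andP[]]].
set T := sup S.
have T0 : 0 <= T by apply: sup_upper_bound.
have Ta : T <= a by apply: ge_sup; [exists 0 | move=> s [/andP[]]].
have inT u : 0 <= u < T -> D° (w + u *: h).
  move=> /andP[u0 uT]; have [|s [_ Ss] us] := sup_adherent (eps := T - u) _ supS.
    by rewrite subr_gt0.
  apply: Ss; rewrite u0 ltW//; move: us; rewrite -/T; lra.
have [DT|nDT] := pselect (D° (w + T *: h)).
  have [e e0 eD] := nbhs_line (nbhs_interior DT).
  have ST : S (Num.min (T + e / 2) a).
    split=> [|u /andP[u0]].
      by rewrite ge_min lexx orbT le_min a0 andbT addr_ge0// divr_ge0// ltW.
    rewrite le_min => /andP[uT ua]; have [uT'|Tu] := ltP u T.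
      by apply: inT; rewrite u0.
    by apply: eD; rewrite ger0_norm ?subr_ge0//; lra.
  have : Num.min (T + e / 2) a <= T by apply: sup_upper_bound.
  rewrite ge_min; have [|_ /= aT] := leP (T + e / 2) T; first lra.
  by have -> : a = T by apply/eqP; rewrite eq_le Ta aT.
exfalso; have T_gt0 : 0 < T.
  rewrite lt_neqAle T0 andbT; apply: contra_notN nDT => /eqP <-.
  by rewrite scale0r addr0.
(* A bound on the slope at all times before [T]; it does not depend on [u] because [M] does not. *)
pose C := `|Dk 1 phi w h| + M * a.
have bnd u : 0 <= u < T -> phi (w + u *: h) <= phi w + C * a.
  move=> /andP[u0 uT]; have ua : u <= a by apply: le_trans (ltW uT) Ta.
  have uD s : 0 <= s <= u -> D° (w + s *: h).
    by move=> /andP[s0 su]; apply: inT; rewrite s0 (le_lt_trans su).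
  have fM s : 0 <= s <= u -> Dk 2 phi (w + s *: h) h <= M.
    move=> /andP[s0 su].
    have sD v : 0 <= v <= s -> D° (w + v *: h).
      by move=> /andP[v0 vs]; apply: uD; rewrite v0 (le_trans vs).
    apply: (HM (fun v => Dk 2 phi (w + v *: h) h) (fun v => Dk 3 phi (w + v *: h) h)).
    - by move=> v /sD/(Dk_line scb)[].
    - by move=> v /sD; exact: Dk2_ge0 nscb.
    - by move=> v /sD; exact: scb_concordant.
    - by rewrite scale0r addr0.
    - by rewrite s0 (le_trans su).
  have M0 : 0 <= M.
    have /fM : 0 <= (0 : R) <= u by rewrite u0 andbT.
    by apply: le_trans; rewrite scale0r addr0.
  have gC s : 0 <= s <= u -> Dk 1 phi (w + s *: h) h <= C.
    move=> /andP[s0 su].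
    have : M * 0 - Dk 1 phi (w + 0 *: h) h <= M * s - Dk 1 phi (w + s *: h) h.
      apply: (@le_is_derive _ (fun v => M * v - Dk 1 phi (w + v *: h) h)
        (fun v => M - Dk 2 phi (w + v *: h) h)) => // v /andP[v0 vs].
        have /uD/(Dk_line scb)[_ ? _] : 0 <= v <= u by rewrite v0 (le_trans vs).
        by apply: is_deriveB; exact: is_derive_mull.
      by rewrite subr_ge0 fM// v0 (le_trans vs).
    rewrite scale0r addr0 /C; have := ler_norm (Dk 1 phi w h).
    have : M * s <= M * a by rewrite ler_wpM2l// (le_trans su).
    lra.
  have : C * 0 - phi (w + 0 *: h) <= C * u - phi (w + u *: h).
    apply: (@le_is_derive _ (fun v => C * v - phi (w + v *: h))
        (fun v => C - Dk 1 phi (w + v *: h) h)) => // v vu.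
      have /(Dk_line scb)[? _ _] := uD _ vu.
      by apply: is_deriveB; exact: is_derive_mull.
    by rewrite subr_ge0 gC.
  rewrite scale0r addr0; have : C * u <= C * a.
    by rewrite ler_wpM2l// addr_ge0 ?mulr_ge0.
  lra.
have near_T B : nbhs (w + T *: h) B -> exists u, 0 <= u < T /\ B (w + u *: h).
  move=> /nbhs_line[e e0 eB]; exists (Num.max 0 (T - e / 2)); split.
    by rewrite le_max lexx /= gt_max T_gt0 /=; lra.
  apply: eB; rewrite ltr_norml; have [?|?] := leP 0 (T - e / 2); apply/andP; split; lra.
have bT : boundary D (w + T *: h).
  split=> // B /near_T[u [uT Bu]]; exists (w + u *: h); split=> //.
  exact: interior_subset (inT _ uT).
have /cvgryPgt/(_ (phi w + C * a)) := scb_boundary scb bT.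
rewrite near_withinE => /near_T[u [uT /(_ (inT _ uT))]].
by rewrite ltNge bnd.
Qed.

End Barrier.

(** * Symmetry of second derivatives *)

Section Schwarz.
Context {R : realType} {V : normedModType R}.
Implicit Types (phi : V -> R) (x u v : V) (d : R).

(** Two mean value theorems: along [u] for the increment of [phi] under the shift [d *: v], then
    along [v] for the derivative in direction [u]. *)
Lemma second_difference phi x u v d : 0 <= d ->
  (forall s t, 0 <= s <= d -> 0 <= t <= d ->
    differentiable phi (x + s *: u + t *: v) /\
    differentiable ('D_u phi) (x + s *: u + t *: v)) ->
  exists s t, [/\ 0 <= s <= d, 0 <= t <= d &
    phi (x + d *: u + d *: v) - phi (x + d *: u) - (phi (x + d *: v) - phi x) =
    'D_v ('D_u phi) (x + s *: u + t *: v) * d * d].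
Proof.
move=> d0 dphi; have dd : 0 <= d <= d by rewrite d0 lexx.
have zd : 0 <= (0 : R) <= d by rewrite lexx.
pose p s := phi (x + d *: v + s *: u) - phi (x + s *: u).
have [|s sd Es] := @MVT_is_derive R p
    (fun s => 'D_u phi (x + d *: v + s *: u) - 'D_u phi (x + s *: u)) 0 d d0.
  move=> s sd; apply: is_deriveB; apply: is_derive_line.
    by rewrite addrAC; have [] := dphi s d sd dd.
  by have [] := dphi s 0 sd zd; rewrite scale0r addr0.
have [|t td Et] := @MVT_is_derive R (fun t => 'D_u phi (x + s *: u + t *: v))
    (fun t => 'D_v ('D_u phi) (x + s *: u + t *: v)) 0 d d0.
  by move=> t td; apply: is_derive_line; have [] := dphi s t sd td.
exists s, t; split=> //.
move: Es Et; rewrite /p !subr0 !scale0r !addr0 => Es Et.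
rewrite -Et [x + s *: u + d *: v]addrAC -Es [x + d *: u + d *: v]addrAC.
move: (phi (x + d *: v + d *: u)) (phi (x + d *: u)) (phi (x + d *: v)) (phi x).
by move=> a b c e; ring.
Qed.

Lemma nbhs_plane x u v (B : set V) : nbhs x B ->
  exists2 d, 0 < d & forall s t, 0 <= s <= d -> 0 <= t <= d ->
    B (x + s *: u + t *: v).
Proof.
move=> /nbhs_ballP[e /= e0 eB]; pose k := `|u| + `|v| + 1.
have k0 : 0 < k by rewrite /k ltr_wpDl// addr_ge0.
exists (e / (2 * k)) => [|s t /andP[s0 sd] /andP[t0 td]].
  by rewrite divr_gt0// mulr_gt0.
apply: eB; rewrite -ball_normE /ball_ /= -addrA opprD addNKr normrN.
have kd : k * (e / (2 * k)) = e / 2 by field; rewrite gt_eqF.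
rewrite (le_lt_trans (ler_normD _ _))// !normrZ !ger0_norm//.
have : s * `|u| <= e / (2 * k) * `|u| by rewrite ler_wpM2r.
have : t * `|v| <= e / (2 * k) * `|v| by rewrite ler_wpM2r.
move: kd; rewrite {1}/k; set z := e / (2 * k) => kd.
have : 0 < z by rewrite divr_gt0// mulr_gt0.
nra.
Qed.

(** The second difference is symmetric in [u] and [v], so the two mixed derivatives agree at two
    points arbitrarily close to [x]; continuity moves both points to [x]. *)
Lemma derive_comm phi x u v :
  (\forall y \near x, differentiable phi y) ->
  (\forall y \near x, differentiable ('D_u phi) y) ->
  (\forall y \near x, differentiable ('D_v phi) y) ->
  {for x, continuous ('D_v ('D_u phi))} ->
  {for x, continuous ('D_u ('D_v phi))} ->
  'D_v ('D_u phi) x = 'D_u ('D_v phi) x.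
Proof.
move=> d0 du dv cvu cuv; apply/eqP; rewrite -subr_eq0 -normr_le0.
apply/ler_addgt0Pr => e e0; rewrite add0r.
have e20 : 0 < e / 2 by rewrite divr_gt0.
have nvu : \forall y \near x, `|'D_v ('D_u phi) x - 'D_v ('D_u phi) y| < e / 2.
  exact: cvgr_dist_lt cvu _ e20.
have nuv : \forall y \near x, `|'D_u ('D_v phi) x - 'D_u ('D_v phi) y| < e / 2.
  exact: cvgr_dist_lt cuv _ e20.
have [d dpos dP] := @nbhs_plane x u v _
  (filterI d0 (filterI du (filterI dv (filterI nvu nuv)))).
have [|s [t [sd td E]]] := @second_difference phi x u v d (ltW dpos).
  by move=> s t sd td; have [? [? _]] := dP s t sd td.
have [|t' [s' [td' sd' E']]] := @second_difference phi x v u d (ltW dpos).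
  by move=> t' s' td' sd'; rewrite addrAC; have [? [_ [? _]]] := dP s' t' sd' td'.
have dn : d != 0 by rewrite gt_eqF.
have ptC a b : x + a *: v + b *: u = x + b *: u + a *: v := addrAC _ _ _.
have L : phi (x + d *: u + d *: v) - phi (x + d *: u) - (phi (x + d *: v) - phi x) =
    phi (x + d *: v + d *: u) - phi (x + d *: v) - (phi (x + d *: u) - phi x).
  rewrite (congr1 phi (ptC d d)).
  move: (phi (x + d *: u + d *: v)) (phi (x + d *: u)) (phi (x + d *: v)) (phi x).
  by move=> a b c f; ring.
(* Cancelling [d] twice equates the mixed derivatives at the two intermediate points. *)
have {L E E'} pq := mulIf dn (mulIf dn (etrans (esym E) (etrans L E'))).
have [_ [_ [_ [b1 _]]]] := dP s t sd td.
have [_ [_ [_ [_ b2]]]] := dP s' t' sd' td'.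
have {}b2 := eq_ind _ (fun z => `|'D_u ('D_v phi) x - 'D_u ('D_v phi) z| < e / 2)
  b2 _ (esym (ptC t' s')).
have {}b1 := eq_ind _ (fun z => `|'D_v ('D_u phi) x - z| < e / 2) b1 _ pq.
have {}b2 := eq_ind _ (fun z => z < e / 2) b2 _ (distrC _ _).
have b12 := le_trans (ler_distD _ _ _) (lerD (ltW b1) (ltW b2)).
by rewrite (splitr e); exact: b12.
Qed.

End Schwarz.

(** * Cauchy-Schwarz for a positive definite matrix and its inverse *)

Section PositiveDefinite.
Context {R : realType} {n : nat}.
Variable H : 'M[R]_n.
Hypotheses (H_sym : H^T = H)
  (H_pos : forall h : 'cV[R]_n, h != 0 -> 0 < (h^T *m H *m h) 0 0).

Lemma posdef_unitmx : H \in unitmx.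
Proof.
rewrite -row_free_unit -kermx_eq0; apply: contraT => k0.
have kH : nz_row (kermx H) *m H = 0 by apply/sub_kermxP/nz_row_sub.
have /H_pos : (nz_row (kermx H))^T != 0.
  by rewrite -trmx0 (inj_eq trmx_inj) nz_row_eq0.
by rewrite trmxK kH mul0mx mxE ltxx.
Qed.

Lemma posdef_cauchy_schwarz (v h : 'cV[R]_n) :
  `|(v^T *m h) 0 0| <=
  Num.sqrt ((v^T *m invmx H *m v) 0 0) * Num.sqrt ((h^T *m H *m h) 0 0).
Proof.
have [->|h0] := eqVneq h 0.
  by rewrite mulmx0 mxE normr0 mulr_ge0 ?sqrtr_ge0.
pose B (x y : 'cV[R]_n) := (x^T *m H *m y) 0 0.
pose u := invmx H *m v.
have Hu : H *m u = v by rewrite /u mulKVmx// posdef_unitmx.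
have -> : (v^T *m h) 0 0 = B u h by rewrite -Hu trmx_mul H_sym.
have -> : (v^T *m invmx H *m v) 0 0 = B u u.
  by rewrite -mulmxA -/u -{1}Hu trmx_mul H_sym.
rewrite -/(B h h); have Bh : 0 < B h h by exact: H_pos.
have B_sym x y : B x y = B y x.
  by rewrite /B -[x^T *m H *m y]trmxK mxE !trmx_mul trmxK H_sym mulmxA.
(* The minimizer of the quadratic form along [u + s *: h]. *)
pose s := - B u h / B h h.
have B_ge0 x : 0 <= B x x.
  have [->|/H_pos/ltW//] := eqVneq x 0.
  by rewrite /B mulmx0 mxE.
have : 0 <= B (u + s *: h) (u + s *: h) by [].
have -> : B (u + s *: h) (u + s *: h) = B u u - B u h ^+ 2 / B h h.
  have -> : B (u + s *: h) (u + s *: h) = B u u + s * B u h + (s * B h u + s * s * B h h).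
    have uT : (u + s *: h)^T = u^T + s *: h^T by rewrite linearD linearZ.
    rewrite /B uT !mulmxDl !mulmxDr -!scalemxAl -!scalemxAr.
    have addE (a b : 'M[R]_1) : (a + b) 0 0 = a 0 0 + b 0 0 by rewrite mxE.
    have scaleE k (a : 'M[R]_1) : (k *: a) 0 0 = k * a 0 0 by rewrite mxE.
    by rewrite !(addE, scaleE); ring.
  rewrite (B_sym h u) /s; field; rewrite gt_eqF//.
rewrite subr_ge0 ler_pdivrMr// => le.
by rewrite -sqrtrM// -sqrtr_sqr ler_wsqrtr.
Qed.

End PositiveDefinite.

(** * The Hessian of a barrier and the geometry of the neighbourhood *)

Section BarrierHessian.
Context {R : realType} {n : nat}.
Variables (D : set 'cV[R]_n) (phi : 'cV[R]_n -> R) (nu : R).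
Hypotheses (nu_gt0 : 0 < nu) (nscb : nu_self_concordant_barrier nu D phi).
Implicit Types (w x y h c : 'cV[R]_n).

Lemma derive_unitvec (f : 'cV[R]_n -> R) x h : differentiable f x ->
  'D_h f x = \sum_i h i 0 * 'D_(unitvec R i) f x.
Proof.
move=> df; rewrite deriveE//.
have {1}-> : h = \sum_i h i 0 *: unitvec R i.
  rewrite [LHS]matrix_sum_delta; apply: eq_bigr => i _.
  by rewrite big_ord1.
rewrite linear_sum /=; apply: eq_bigr => i _.
by rewrite linearZ deriveE.
Qed.

Lemma Dk1E x h : D° x -> Dk 1 phi x h = ((grad phi x)^T *m h) 0 0.
Proof.
move=> Dx; have [d0 _ _] := scb_differentiable nscb.1 h h Dx.
rewrite /Dk /= derive_unitvec// mxE; apply: eq_bigr => i _.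
by rewrite !mxE mulrC.
Qed.

Lemma Dk2E x h : D° x -> Dk 2 phi x h = (h^T *m hess phi x *m h) 0 0.
Proof.
move=> Dx; have [_ d1 _] := scb_differentiable nscb.1 h h Dx.
rewrite /Dk /= derive_unitvec// -mulmxA mxE; apply: eq_bigr => i _.
rewrite mxE; congr (_ * _).
(* The expansion of ['D_h phi] in partial derivatives holds only on the interior, which suffices for
   differentiating at [x]. *)
have -> : 'D_(unitvec R i) ('D_h phi) x =
    'D_(unitvec R i) (\sum_j h j 0 *: 'D_(unitvec R j) phi) x.
  apply: near_eq_derive; near=> y.
  have Dy : D° y by near: y; exact: nbhs_interior.
  have [d0 _ _] := scb_differentiable nscb.1 h h Dy.
  by rewrite derive_unitvec// fct_sumE; apply: eq_bigr.
have dj j : derivable (h j 0 *: 'D_(unitvec R j) phi) x (unitvec R i).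
  have [_ + _] := scb_differentiable nscb.1 (unitvec R j) h Dx.
  by move=> ?; apply: derivableZ; exact: diff_derivable.
rewrite derive_sum// mxE; apply: eq_bigr => j _.
have [_ dj' _] := scb_differentiable nscb.1 (unitvec R j) h Dx.
rewrite deriveZ; last exact: diff_derivable.
by rewrite mxE mulrC.
Unshelve. all: by end_near. Qed.

Lemma hess_sym x : D° x -> (hess phi x)^T = hess phi x.
Proof.
move=> Dx; apply/matrixP => i j; rewrite !mxE; apply: derive_comm.
- near=> y; have Dy : D° y by near: y; exact: nbhs_interior.
  by have [] := scb_differentiable nscb.1 0 0 Dy.
- near=> y; have Dy : D° y by near: y; exact: nbhs_interior.
  by have [] := scb_differentiable nscb.1 (unitvec R i) 0 Dy.
- near=> y; have Dy : D° y by near: y; exact: nbhs_interior.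
  by have [] := scb_differentiable nscb.1 (unitvec R j) 0 Dy.
- have [_ _ d] := scb_differentiable nscb.1 (unitvec R j) (unitvec R i) Dx.
  exact: differentiable_continuous.
- have [_ _ d] := scb_differentiable nscb.1 (unitvec R i) (unitvec R j) Dx.
  exact: differentiable_continuous.
Unshelve. all: by end_near. Qed.

Hypothesis D_noray : forall w h, h != 0 -> exists2 a, 0 <= a & ~ D (w + a *: h).

(** A direction with zero second derivative would have a Dikin ball containing a whole ray, which
    [D_noray] excludes. *)
Lemma hess_posdef x h : D° x -> h != 0 -> 0 < (h^T *m hess phi x *m h) 0 0.
Proof.
move=> Dx h0; rewrite -Dk2E// lt_neqAle (Dk2_ge0 _ (ltW nu_gt0) nscb)// andbT.
apply/eqP => D2; have [a a0] := D_noray x h0; apply; apply: interior_subset.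
by apply: (dikin_interior (ltW nu_gt0) nscb) => //; rewrite -D2 sqrtr0 mulr0.
Qed.

Hypothesis D_convex : forall x y s, D x -> D y -> 0 <= s <= 1 ->
  D ((1 - s) *: x + s *: y).

(** The homothety with centre [y] and ratio [1 - s] maps a neighbourhood of [x] within [D] onto one
    of the new point; [k] below is its inverse. *)
Lemma interior_open_segment x y s : D° x -> D y -> 0 <= s < 1 ->
  D° (x + s *: (y - x)).
Proof.
move=> Dx Dy /andP[s0 s1]; have s1' : 0 < 1 - s by rewrite subr_gt0.
pose k z : 'cV[R]_n := (1 - s)^-1 *: (z - s *: y).
have kx : k (x + s *: (y - x)) = x.
  have -> : k (x + s *: (y - x)) = (1 - s)^-1 *: ((1 - s) *: x).
    congr (_ *: _); rewrite scalerBl scale1r scalerBr.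
    by rewrite [s *: y - _]addrC addrA addrK.
  by rewrite scalerA mulVf ?scale1r// gt_eqF.
have kc : continuous_at (x + s *: (y - x)) k.
  exact: differentiable_continuous.
have : nbhs (k (x + s *: (y - x))) D by rewrite kx.
move=> /kc kD; have {}kD : \forall z \near x + s *: (y - x), D (k z) by exact: kD.
suff : \forall z \near x + s *: (y - x), D z by [].
near=> z; have Dk : D (k z) by near: z.
have -> : z = (1 - s) *: k z + s *: y.
  by rewrite /k scalerA mulfV ?scale1r ?subrK// gt_eqF.
by apply: D_convex => //; rewrite s0 ltW.
Unshelve. all: by end_near. Qed.

(* The sublevel set of the cost through [w] lies within [3 + 4 nu] local radii
   of [w], while [D] contains the open unit ball: reflecting [y] through [w]
   and shrinking by that factor stays in [D]. *)
Lemma l2_nbhd_reflect c theta w y a : theta < 1 / 2 ->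
  l2_nbhd c D phi theta w -> D y -> (c^T *m y) 0 0 <= (c^T *m w) 0 0 ->
  0 <= a -> a * (3 + 4 * nu) < 1 -> D (w - a *: (y - w)).
Proof.
move=> theta2 [mu /= mu0 [Dw wmu]] Dy cyw a0 aC.
set h := y - w; set q := Num.sqrt (Dk 2 phi w h).
pose v := c + mu *: grad phi w.
have ch : (c^T *m h) 0 0 <= 0.
  by rewrite mulmxBr mxE [X in _ + X]mxE subr_le0.
have vh : - (theta * mu * q) <= (v^T *m h) 0 0.
  have := posdef_cauchy_schwarz (hess_sym Dw) (fun k => @hess_posdef w k Dw) v h.
  rewrite -Dk2E// -/q -/(dual_norm phi w v) => cs.
  have le : `|(v^T *m h) 0 0| <= theta * mu * q.
    by apply: le_trans cs _; rewrite ler_wpM2r ?sqrtr_ge0.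
  by move: le; rewrite ler_norml => /andP[].
have g0 : - theta * q <= Dk 1 phi w h.
  have vT : v^T = c^T + mu *: (grad phi w)^T by rewrite linearD linearZ.
  move: vh; rewrite Dk1E// vT mulmxDl mxE -scalemxAl [X in _ + X]mxE.
  move: ((grad phi w)^T *m h) ((c^T *m h) 0 0) ch => G C C0 le.
  rewrite -(ler_pM2l mu0) mulNr mulrN mulrA [mu * theta]mulrC.
  by apply: le_trans le _; rewrite gerDr.
have seg s : 0 <= s < 1 -> D° (w + s *: h) by exact: interior_open_segment.
have qC : q <= 3 + 4 * nu.
  have E0 : w + 0 *: h = w by rewrite scale0r addr0.
  have g0' := eq_ind _ (fun z => - theta * q <= Dk 1 phi z h) g0 _ (esym E0).
  have f0 := congr1 (fun z => Dk 2 phi z h) E0.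
  apply: (@concordant_length R (fun s => Dk 1 phi (w + s *: h) h)
    (fun s => Dk 2 phi (w + s *: h) h) (fun s => Dk 3 phi (w + s *: h) h)
    nu theta _ _ _ _ _ _ nu_gt0 theta2 f0 g0').
  - by move=> s /seg/(Dk_line nscb.1)[].
  - by move=> s /seg/(Dk_line nscb.1)[].
  - by move=> s /seg; exact: Dk2_ge0 (ltW nu_gt0) nscb.
  - by move=> s /seg Ds; apply: scb_concordant Ds; exact: nscb.1.
  - by move=> s /seg; exact: nscb.2.
apply: interior_subset; rewrite -scalerN; apply: (dikin_interior (ltW nu_gt0) nscb) => //.
have -> : Dk 2 phi w (- h) = Dk 2 phi w h.
  have hT : (- h)^T = - h^T by rewrite linearN.
  by rewrite !Dk2E// hT !mulNmx mulmxN opprK.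
by rewrite -/q (le_lt_trans _ aC)// ler_wpM2l.
Qed.

End BarrierHessian.

(** * The zigzag of the exponents *)

Section Exponents.
Context {R : realType}.
Implicit Types (l : R) (j n m : nat).

(* Base-[t] logarithms, up to [O(1 / ln t)], of the largest values of the
   coordinates [2 j + 1] and [2 j + 2] on the feasible points with
   [coord1 x 1 <= t `^ l]. *)
Fixpoint expo l j : R * R :=
  if j is j'.+1 then
    (1 + Num.min (expo l j').1 (expo l j').2,
     1 - 1 / 2 ^+ j + Num.max (expo l j').1 (expo l j').2)
  else (l, 1).

Definition expo_gap l j : R := (expo l j).1 - (expo l j).2.

(** Minimum minus maximum is minus the absolute difference: each level folds the gap like a tent
    map. *)
Lemma expo_gapS l j : expo_gap l j.+1 = 2 ^- j.+1 - `|expo_gap l j|.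
Proof.
rewrite /expo_gap /= div1r; set a := (expo l j).1; set b := (expo l j).2.
have [ab|ba] := leP a b.
  by rewrite ler0_norm ?subr_le0//; ring.
by rewrite gtr0_norm ?subr_gt0//; ring.
Qed.

(** Minimum plus maximum is the plain sum, so the sum of both exponents grows with slope 1 in [l].
    Together with the gap it determines each exponent. *)
Lemma expo_sum l l' j :
  (expo l j).1 + (expo l j).2 - l = (expo l' j).1 + (expo l' j).2 - l'.
Proof.
elim: j => [|j IH] /=; first by ring.
have addE (a b c : R) : 1 + Num.min a b + (c + Num.max a b) = 1 + c + (a + b).
  by rewrite addrACA addr_min_max.
rewrite !addE; move: IH.
by move: (1 / _) (expo l j) (expo l' j) => c [a b] [a' b'] /=; lra.
Qed.

Lemma expo_gap_lipschitz l l' j : `|expo_gap l j - expo_gap l' j| <= `|l - l'|.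
Proof.
elim: j => [|j IH].
  by rewrite /expo_gap /=; have -> : l - 1 - (l' - 1) = l - l' by ring.
rewrite !expo_gapS; set a := expo_gap l j; set b := expo_gap l' j.
have -> : 2 ^- j.+1 - `|a| - (2 ^- j.+1 - `|b|) = - (`|a| - `|b|) by ring.
by rewrite normrN (le_trans (ler_dist_dist _ _)).
Qed.

Lemma norm_midpoint (a b c d : R) : `|a - b| <= d -> `|a - c| <= d ->
  `|b| = 0 -> `|c| = 2 * d -> `|a| = d.
Proof.
move=> ab ac /eqP; rewrite normr_eq0 => /eqP b0 cd.
move: ab; rewrite b0 subr0 => ad.
have := ler_normB a (a - c); rewrite subKr cd => ?.
by apply/eqP; rewrite eq_le ad /=; lra.
Qed.

(** Even nodes are nodes of the coarser grid. An odd node lies midway between a coarse zero and a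
    coarse extremum of height [2 * d], so the Lipschitz bound forces absolute gap [d] there, which
    folding turns into 0. *)
Lemma expo_gap_grid j n : (n <= 2 ^ j.+1)%N ->
  `|expo_gap (n%:R / 2 ^+ j) j| = if odd n then 0 else 2 ^- j.
Proof.
elim: j n => [|j IH] n nj.
  rewrite /expo_gap /= expr0 divr1 invr1.
  case: n nj => [|[|[|//]]] _ /=; first by rewrite sub0r normrN1.
    by rewrite subrr normr0.
  have -> : 2 - 1 = 1 :> R by ring.
  by rewrite normr1.
set d : R := 2 ^- j.+1; have d0 : 0 < d by rewrite invr_gt0 exprn_gt0.
have dE : 2 ^- j = 2 * d.
  by rewrite /d exprS invfM mulrA divff ?mul1r// pnatr_eq0.
have grid m : (2 * m)%:R / 2 ^+ j.+1 = m%:R / 2 ^+ j :> R.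
  by rewrite exprS natrM invfM mulrACA divff ?mul1r// pnatr_eq0.
have nE := odd_double_half n; rewrite -mul2n in nE.
rewrite expo_gapS -/d; case: ifPn nE => /= on nE.
  have mj : (n./2.+1 <= 2 ^ j.+1)%N.
    by move: nj; rewrite [(2 ^ j.+2)%N]expnS; lia.
  have l1 := expo_gap_lipschitz (n%:R / 2 ^+ j.+1) (n./2%:R / 2 ^+ j) j.
  have l2 := expo_gap_lipschitz (n%:R / 2 ^+ j.+1) (n./2.+1%:R / 2 ^+ j) j.
  have := IH _ (ltnW mj); have := IH _ mj.
  move: l1 l2; rewrite -!grid -!mulrBl -!/d.
  have -> : n%:R - (2 * n./2)%:R = 1 :> R.
    by rewrite -{1}nE natrD addrK.
  have -> : n%:R - (2 * n./2.+1)%:R = -1 :> R.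
    by rewrite -{1}nE mulnS !natrD; ring.
  rewrite normrM normr1 normrM normrN1 !mul1r gtr0_norm// dE /=.
  move=> l1 l2 c b; suff -> : `|expo_gap (n%:R / 2 ^+ j.+1) j| = d.
    by rewrite subrr normr0.
  case: (odd n./2) b c => /= b c.
    exact: norm_midpoint l1 l2 b c.
  exact: norm_midpoint l2 l1 c b.
have mj : (n./2 <= 2 ^ j.+1)%N.
  by move: nj; rewrite [(2 ^ j.+2)%N]expnS; lia.
rewrite add0n in nE; rewrite -nE grid IH//; case: ifP => _.
  by rewrite subr0 gtr0_norm.
by rewrite dE; have -> : d - 2 * d = - d; [ring | rewrite normrN gtr0_norm].
Qed.

(** The gap vanishes at both odd nodes, so each exponent rises by [2 ^- j] in between. At the middle
    node the sum has risen by [2 ^- j] and the gap is that large too: one exponent has made its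
    whole rise, the other none. *)
Lemma expo_turn j m : (2 * m + 3 <= 2 ^ j.+1)%N ->
  let l (k : nat) : R := k%:R / 2 ^+ j in
  ((expo (l (2 * m + 2)%N) j).1 = (expo (l (2 * m + 1)%N) j).1 + 2 ^- j /\
   (expo (l (2 * m + 3)%N) j).1 = (expo (l (2 * m + 1)%N) j).1 + 2 ^- j) \/
  ((expo (l (2 * m + 2)%N) j).2 = (expo (l (2 * m + 1)%N) j).2 + 2 ^- j /\
   (expo (l (2 * m + 3)%N) j).2 = (expo (l (2 * m + 1)%N) j).2 + 2 ^- j).
Proof.
move=> mj l; set d : R := 2 ^- j; have d0 : 0 < d by rewrite invr_gt0 exprn_gt0.
have g k : (k <= 2 * m + 3)%N -> `|expo_gap (l k) j| = if odd k then 0 else d.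
  by move=> km; apply/expo_gap_grid/(leq_trans km mj).
have oddE k : odd (2 * m + k) = odd k by rewrite oddD oddM.
have g1 : `|expo_gap (l (2 * m + 1)%N) j| = 0 by rewrite g ?leq_add2l// oddE.
have g3 : `|expo_gap (l (2 * m + 3)%N) j| = 0 by rewrite g ?leq_add2l// oddE.
have g2 : `|expo_gap (l (2 * m + 2)%N) j| = d by rewrite g ?leq_add2l// oddE.
have lE (k i : nat) : l (k + i)%N = l k + i%:R * d by rewrite /l natrD mulrDl.
have l2 : l (2 * m + 2)%N = l (2 * m + 1)%N + d.
  by rewrite [(2 * m + 2)%N](addnA _ 1 1) lE mul1r.
have l3 : l (2 * m + 3)%N = l (2 * m + 1)%N + 2 * d.
  by rewrite [(2 * m + 3)%N](addnA _ 1 2) lE.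
have s3 := expo_sum (l (2 * m + 3)%N) (l (2 * m + 1)%N) j.
rewrite [X in _ - X = _]l3 in s3.
have s2 := expo_sum (l (2 * m + 2)%N) (l (2 * m + 1)%N) j.
rewrite [X in _ - X = _]l2 in s2.
move: g1 g3 g2 s2 s3; rewrite /expo_gap.
move: (expo (l (2 * m + 1)%N) j) (expo (l (2 * m + 2)%N) j) (expo (l (2 * m + 3)%N) j).
move: (l (2 * m + 1)%N) => l1 [a1 b1] [a2 b2] [a3 b3] /=.
move=> /eqP; rewrite normr_eq0 => /eqP ab1 /eqP; rewrite normr_eq0 => /eqP ab3.
move=> ab2 s2 s3; have [ab|ab] := leP 0 (a2 - b2); [left|right].
  by move: ab2; rewrite ger0_norm// => ab2; split; lra.
by move: ab2; rewrite ltr0_norm// => ab2; split; lra.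
Qed.

End Exponents.

(** * The polytope of the linear program and its largest coordinates *)

Section LongWindingGeometry.
Context {R : realType} {r : nat}.
Variable t : R.
Implicit Types (x y h : 'cV[R]_(2 * r)) (l : R) (j k : nat).
Local Notation F := (@LW_feasible R r t).

Lemma coord1D x y k : coord1 (x + y) k = coord1 x k + coord1 y k.
Proof. by rewrite /coord1; case: insub => [i|]; rewrite ?mxE ?addr0. Qed.

Lemma coord1Z (a : R) x k : coord1 (a *: x) k = a * coord1 x k.
Proof. by rewrite /coord1; case: insub => [i|]; rewrite ?mxE ?mulr0. Qed.

Lemma coord1N x k : coord1 (- x) k = - coord1 x k.
Proof. by rewrite -scaleN1r coord1Z mulN1r. Qed.

Lemma coord1_ord x (i : 'I_(2 * r)) : coord1 x i.+1 = x i 0.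
Proof. by rewrite /coord1 /= valK. Qed.

Definition LW_vertex l : 'cV[R]_(2 * r) :=
  \col_i t `^ (if odd i then (expo l i./2).2 else (expo l i./2).1).

Lemma LW_vertexE l j : (j < r)%N ->
  coord1 (LW_vertex l) (2 * j + 1) = t `^ (expo l j).1 /\
  coord1 (LW_vertex l) (2 * j + 2) = t `^ (expo l j).2.
Proof.
move=> jr; have l1 : (2 * j < 2 * r)%N by lia.
have l2 : (2 * j + 1 < 2 * r)%N by lia.
have -> : (2 * j + 1 = (Ordinal l1).+1)%N by rewrite addn1.
have -> : (2 * j + 2 = (Ordinal l2).+1)%N by rewrite addnS.
rewrite !coord1_ord !mxE /= oddD oddM /= mul2n.
by rewrite doubleK addn1 /= uphalf_double.
Qed.

Hypothesis r_gt0 : (0 < r)%N.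

Let last_lt : (r.-1 < r)%N. Proof. by rewrite ltn_predL. Qed.

(* [j] is shifted by one to avoid truncated subtraction. *)
Lemma LW_feasibleP x : F x <->
  [/\ coord1 x 1 <= t ^+ 2, coord1 x 2 <= t,
      forall j, (j.+1 < r)%N ->
        [/\ coord1 x (2 * j.+1 + 1) <= t * coord1 x (2 * j + 1),
            coord1 x (2 * j.+1 + 1) <= t * coord1 x (2 * j + 2) &
            coord1 x (2 * j.+1 + 2) <= t `^ (1 - 1 / 2 ^+ j.+1) *
              (coord1 x (2 * j + 1) + coord1 x (2 * j + 2))],
      0 <= coord1 x (2 * r.-1 + 1) & 0 <= coord1 x (2 * r.-1 + 2)].
Proof.
have e1 j : (2 * j.+1 - 1 = 2 * j + 1)%N by lia.
have e2 j : (2 * j.+1 = 2 * j + 2)%N by lia.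
have er1 : (2 * r - 1 = 2 * r.-1 + 1)%N by lia.
have er2 : (2 * r = 2 * r.-1 + 2)%N by lia.
rewrite /LW_feasible /= er1 -er2; split=> -[h1 h2 h3 h4 h5]; split=> // j jr.
  by have := h3 j.+1 jr; rewrite e1 -(e2 j).
by case: j jr => // j jr; have := h3 j jr; rewrite e1 -(e2 j).
Qed.

Lemma LW_convex x y (s : R) : F x -> F y -> 0 <= s <= 1 -> F ((1 - s) *: x + s *: y).
Proof.
move=> /LW_feasibleP[x1 x2 x3 x4 x5] /LW_feasibleP[y1 y2 y3 y4 y5] /andP[s0 s1].
have s1' : 0 <= 1 - s by rewrite subr_ge0.
have mix (a b c d : R) : a <= b -> c <= d -> (1 - s) * a + s * c <= (1 - s) * b + s * d.
  by move=> ab cd; rewrite lerD// ler_wpM2l.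
have mixc (k : R) : k = (1 - s) * k + s * k by ring.
apply/LW_feasibleP; split=> [||j jr||]; rewrite !(coord1D, coord1Z).
- by rewrite [leRHS]mixc mix.
- by rewrite [leRHS]mixc mix.
- have [a1 a2 a3] := x3 j jr; have [b1 b2 b3] := y3 j jr.
  split.
  + by rewrite mulrDr ![t * (_ * _)]mulrCA mix.
  + by rewrite mulrDr ![t * (_ * _)]mulrCA mix.
  + have distr (k a b c d : R) : k * ((1 - s) * a + s * b + ((1 - s) * c + s * d)) =
        (1 - s) * (k * (a + c)) + s * (k * (b + d)) by ring.
    by rewrite distr mix.
- by rewrite addr_ge0 ?mulr_ge0.
- by rewrite addr_ge0 ?mulr_ge0.
Qed.

Hypothesis t_gt1 : 1 < t.

Let t_gt0 : 0 < t. Proof. exact: lt_trans t_gt1. Qed.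

(** Backward induction from the last pair: [t] times either coordinate of a pair dominates the first
    coordinate of the next pair. *)
Lemma LW_coord_ge0 x j : F x -> (j < r)%N ->
  0 <= coord1 x (2 * j + 1) /\ 0 <= coord1 x (2 * j + 2).
Proof.
move=> /LW_feasibleP[_ _ x3 x4 x5].
suff P i : (i < r)%N -> 0 <= coord1 x (2 * (r.-1 - i) + 1) /\
    0 <= coord1 x (2 * (r.-1 - i) + 2).
  move=> jr; have := P (r.-1 - j)%N; have -> : (r.-1 - (r.-1 - j) = j)%N by lia.
  by apply; lia.
elim: i => [|i IH] ir; first by rewrite subn0.
have ei : (r.-1 - i = (r.-1 - i.+1).+1)%N by lia.
have [|i1 _] := IH; first exact: ltnW.
have [|c1 c2 _] := x3 (r.-1 - i.+1)%N; first by lia.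
move: i1; rewrite ei => i1.
by split; rewrite -(pmulr_rge0 _ t_gt0) (le_trans i1).
Qed.

(** Each level costs a factor 2, for bounding a sum of two powers by twice the larger one. *)
Lemma LW_coord_le x l j : F x -> coord1 x 1 <= t `^ l -> (j < r)%N ->
  coord1 x (2 * j + 1) <= 2 ^+ j * t `^ (expo l j).1 /\
  coord1 x (2 * j + 2) <= 2 ^+ j * t `^ (expo l j).2.
Proof.
move=> Fx xl; have /LW_feasibleP[_ x2 x3 _ _] := Fx.
have tD a b : t `^ (a + b) = t `^ a * t `^ b.
  by rewrite powRD// (gt_eqF t_gt0) implybT.
have tle a b : a <= b -> t `^ a <= t `^ b by apply: ler_powR; exact: ltW.
elim: j => [|j IH] jr; first by rewrite !expr0 !mul1r /= powRr1 ?(ltW t_gt0).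
have [Y Z] := IH (ltnW jr); have [c1 c2 c3] := x3 j jr.
have [Y0 Z0] := LW_coord_ge0 Fx (ltnW jr).
have two : 2 ^+ j <= 2 ^+ j.+1 :> R by rewrite ler_weXn2l// ler1n.
rewrite [(expo l j.+1)]/=; move: (expo l j) Y Z => [a b] /= Y Z; split.
  rewrite tD powRr1 ?(ltW t_gt0)//.
  have up c : 2 ^+ j * t `^ c <= 2 ^+ j.+1 * t `^ c by rewrite ler_wpM2r ?powR_ge0.
  rewrite mulrCA; have [ab|ba] := leP a b.
    by apply: le_trans c1 _; rewrite ler_wpM2l ?(ltW t_gt0)// (le_trans Y).
  by apply: le_trans c2 _; rewrite ler_wpM2l ?(ltW t_gt0)// (le_trans Z).
rewrite tD mulrCA; apply: le_trans c3 _; rewrite ler_wpM2l ?powR_ge0//.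
rewrite exprS mulr2n mulrDl mulrDl mul1r.
have : t `^ a <= t `^ Num.max a b by rewrite tle// le_max lexx.
have : t `^ b <= t `^ Num.max a b by rewrite tle// le_max lexx orbT.
move=> bm am; rewrite lerD//.
  by apply: le_trans Y _; rewrite ler_wpM2l// exprn_ge0.
by apply: le_trans Z _; rewrite ler_wpM2l// exprn_ge0.
Qed.

Lemma LW_noray x h : h != 0 -> exists2 a, 0 <= a & ~ F (x + a *: h).
Proof.
move=> h0; have [i hi] : exists i, h i 0 != 0.
  apply/existsP; apply: contraR h0; rewrite negb_exists => /forallP H.
  by apply/eqP/matrixP => i j; rewrite ord1 mxE; apply/eqP/negPn/H.
(* Every feasible point satisfies [coord1 x 1 <= t ^+ 2], so the bounds at [l = 2] apply to the
   whole polytope. *)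
pose M := 2 ^+ i./2 * t `^ (expo 2 i./2).1 + 2 ^+ i./2 * t `^ (expo 2 i./2).2.
have ir : (i./2 < r)%N by have := ltn_ord i; have := odd_double_half i; lia.
have iE : i.+1 = (2 * i./2 + 1)%N \/ i.+1 = (2 * i./2 + 2)%N.
  by have := odd_double_half i; lia.
have bnd y : F y -> 0 <= y i 0 <= M.
  move=> Fy; have y1 : coord1 y 1 <= t `^ 2.
    by have /LW_feasibleP[+ _ _ _ _] := Fy; rewrite powR_mulrn// ltW.
  have [u1 u2] := LW_coord_le Fy y1 ir; have [l1 l2] := LW_coord_ge0 Fy ir.
  have p1 : 0 <= 2 ^+ i./2 * t `^ (expo 2 i./2).1.
    by rewrite mulr_ge0 ?exprn_ge0 ?powR_ge0.
  have p2 : 0 <= 2 ^+ i./2 * t `^ (expo 2 i./2).2.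
    by rewrite mulr_ge0 ?exprn_ge0 ?powR_ge0.
  rewrite -coord1_ord /M; case: iE => ->; apply/andP; split=> //; lra.
have M0 : 0 <= M by rewrite addr_ge0// mulr_ge0 ?exprn_ge0 ?powR_ge0.
have nh : 0 < `|h i 0| by rewrite normr_gt0.
(* This moves coordinate [i] by [M + |x i 0| + 1], out of the interval from 0 to [M]. *)
exists ((M + `|x i 0| + 1) / `|h i 0|).
  by apply: divr_ge0 => //; apply: addr_ge0 => //; exact: addr_ge0.
move=> /bnd; rewrite !mxE; have [hp|hn] := ltP 0 (h i 0).
  rewrite (gtr0_norm hp) divfK ?gt_eqF//; have := ler_norm (- x i 0); rewrite normrN; lra.
rewrite (ler0_norm hn) invrN mulrN mulNr divfK//; have := ler_norm (x i 0); lra.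
Qed.

(** The minimum respects both bounds on the first coordinate of a pair, and the power with the
    maximal exponent is one of the two summands bounding the second. *)
Lemma LW_vertex_feasible l : l <= 2 -> F (LW_vertex l).
Proof.
move=> l2; apply/LW_feasibleP.
have t0 := ltW t_gt0.
have tD a b : t `^ (a + b) = t `^ a * t `^ b.
  by rewrite powRD// (gt_eqF t_gt0) implybT.
have tle a b : a <= b -> t `^ a <= t `^ b by apply: ler_powR; exact: ltW.
have [c1 c2] := LW_vertexE l r_gt0.
split.
- by rewrite c1 /= -powR_mulrn// tle.
- by rewrite c2 /= powRr1.
- move=> j jr; have [-> ->] := LW_vertexE l jr; have [-> ->] := LW_vertexE l (ltnW jr).
  rewrite [(expo l j.+1)]/=; move: (expo l j) => [a b] /=.
  have tS c : t `^ (1 + c) = t * t `^ c by rewrite tD powRr1.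
  split.
  + by rewrite tS ler_wpM2l// tle// ge_min lexx.
  + by rewrite tS ler_wpM2l// tle// ge_min lexx orbT.
  + rewrite [leLHS]tD ler_wpM2l ?powR_ge0//.
    have [_|_] := leP a b; first by rewrite lerDr powR_ge0.
    by rewrite lerDl powR_ge0.
- by have [-> _] := @LW_vertexE l r.-1 (last_lt); exact: powR_ge0.
- by have [_ ->] := @LW_vertexE l r.-1 (last_lt); exact: powR_ge0.
Qed.

End LongWindingGeometry.

(** * Affine interpolation between three costs in geometric progression *)

Section Interpolation.
Context {R : realFieldType}.
Implicit Types (a b T tau X Y u v w e P C : R).

(** [T * tau] is the average of [T] and [T * tau * tau] with weights [tau] and 1 over [tau + 1], and
    other coordinates on the segment are affine in the cost. *)
Lemma interpolation_geometric a b T tau X Y u v w : a - b != 0 ->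
  u * (a - b) = (T - b) * X + (a - T) * Y ->
  v * (a - b) = (T * tau - b) * X + (a - T * tau) * Y ->
  w * (a - b) = (T * tau * tau - b) * X + (a - T * tau * tau) * Y ->
  (tau + 1) * v = tau * u + w.
Proof.
move=> ab hu hv hw; apply: (mulIf ab).
by rewrite -mulrA hv [RHS]mulrDl -[tau * u * _]mulrA hu hw; ring.
Qed.

(** The average of [u] and [w] is below [2 * P * e], whereas having grown already at the corner
    requires [v >= e * tau / C]. *)
Lemma interpolation_turn_absurd tau e P C u v w : 1 < tau -> 0 < e -> 0 < P -> 0 < C ->
  e * tau <= C * v -> (tau + 1) * v = tau * u + w ->
  u <= P * e -> w <= P * (e * tau) -> 2 * P * C < tau -> False.
Proof.
move=> tau1 e0 P0 C0 ev mix ue we big.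
have tau0 : 0 < tau by apply: lt_trans tau1.
have h1 : tau * u <= tau * (P * e) by rewrite ler_pM2l.
have h2 : (tau + 1) * (e * tau) <= (tau + 1) * (C * v).
  by rewrite ler_pM2l// addr_gt0.
have h3 : C * ((tau + 1) * v) <= C * (2 * (P * (e * tau))).
  rewrite ler_pM2l// mix; lra.
have et0 : 0 < e * tau by rewrite mulr_gt0.
have h4 : (tau + 1) * (e * tau) <= 2 * P * C * (e * tau) by lra.
by move: h4; rewrite ler_pM2r// leNgt; lra.
Qed.

End Interpolation.

(** * Segments in the neighbourhood and the count of iterations *)

Section LongWindingPath.
Context {R : realType} {r : nat}.
Variables (t theta nu : R) (phi : 'cV[R]_(2 * r) -> R).
Hypotheses (r_gt0 : (0 < r)%N) (t_gt1 : 1 < t) (nu_gt0 : 0 < nu)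
  (theta_lt : theta < 1 / 2)
  (nscb : nu_self_concordant_barrier nu (@LW_feasible R r t) phi)
  (t_large : 2 ^+ r * (5 + 4 * nu) < t `^ (2 ^- r.-1)).
Implicit Types (x y w : 'cV[R]_(2 * r)).
Local Notation F := (@LW_feasible R r t).
Local Notation Nb := (l2_nbhd (LW_cost R r) F phi theta).

Let t_gt0 : 0 < t. Proof. exact: lt_trans t_gt1. Qed.
Let powRDt a b : t `^ (a + b) = t `^ a * t `^ b.
Proof. by rewrite powRD// (gt_eqF t_gt0) implybT. Qed.

(** The reflected point [w - a *: (y - w)] is feasible, so its last coordinates are nonnegative:
    [a * y_k <= (1 + a) * w_k], with [1 / a = 4 + 4 * nu]. *)
Lemma LW_nbhd_coord_ge w y k : Nb w -> F y -> coord1 y 1 <= coord1 w 1 ->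
  k = (2 * r.-1 + 1)%N \/ k = (2 * r.-1 + 2)%N ->
  coord1 y k <= (5 + 4 * nu) * coord1 w k.
Proof.
move=> Nw Fy yw kE; set a := (4 + 4 * nu)^-1.
have c0 : 0 < 4 + 4 * nu by rewrite addr_gt0// mulr_gt0.
have a0 : 0 < a by rewrite invr_gt0.
have cyw : ((LW_cost R r)^T *m y) 0 0 <= ((LW_cost R r)^T *m w) 0 0.
  by rewrite -/(LW_value y) -/(LW_value w) !LW_valueE.
have aC : a * (3 + 4 * nu) < 1.
  by rewrite /a mulrC ltr_pdivrMr// mul1r; lra.
have Fz := l2_nbhd_reflect nu_gt0 nscb (LW_noray r_gt0 t_gt1) (@LW_convex _ _ _ r_gt0)
  theta_lt Nw Fy cyw (ltW a0) aC.
have : 0 <= coord1 (w - a *: (y - w)) k.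
  have last_lt : (r.-1 < r)%N by rewrite ltn_predL.
  by have [h1 h2] := LW_coord_ge0 r_gt0 t_gt1 Fz last_lt; case: kE => ->.
rewrite coord1D coord1N coord1Z coord1D coord1N subr_ge0 => le.
move: le; rewrite -(ler_pM2l c0) mulrA /a mulfV ?gt_eqF// mul1r; lra.
Qed.

(** Nodes of the zigzag for the last pair: even ones are corners of the staircase, odd ones
    midpoints of its steps. *)
Let pt (l : nat) : R := l%:R / 2 ^+ r.-1.

Lemma LW_segment_crossing x y m : segment x y `<=` Nb ->
  (2 * m + 3 <= 2 ^ r)%N ->
  coord1 y 1 <= t `^ pt (2 * m + 1) -> t `^ pt (2 * m + 3) <= coord1 x 1 -> False.
Proof.
move=> seg mr y1 x3; set j := r.-1; set d : R := 2 ^- j.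
have rj : r = j.+1 by rewrite prednK.
have jr : (j < r)%N by rewrite rj.
set tau := t `^ d.
have d0 : 0 < d by rewrite invr_gt0 exprn_gt0.
have tau1 : 1 < tau.
  have -> : 1 = 1 `^ d :> R by rewrite powR1.
  by apply: gt0_ltr_powR; rewrite ?nnegrE ?(ltW t_gt0).
set T1 := t `^ pt (2 * m + 1); have T1_gt0 : 0 < T1 by rewrite powR_gt0.
have ptE k i : pt (k + i)%N = pt k + i%:R * d by rewrite /pt natrD mulrDl.
have T2E : t `^ pt (2 * m + 2) = T1 * tau.
  by rewrite [(2 * m + 2)%N](addnA _ 1 1) ptE mul1r powRDt.
have T3E : t `^ pt (2 * m + 3) = T1 * tau * tau.
  by rewrite [(2 * m + 3)%N](addnA _ 1 2) ptE mulrDl mul1r !powRDt mulrA.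
have T12 : T1 < T1 * tau by rewrite ltr_pMr.
have T23 : T1 * tau < T1 * tau * tau by rewrite ltr_pMr// mulr_gt0// (lt_trans _ tau1).
have on_seg T : T1 <= T <= T1 * tau * tau -> exists2 p, Nb p &
    coord1 p 1 = T /\ forall k, coord1 p k * (coord1 x 1 - coord1 y 1) =
      (T - coord1 y 1) * coord1 x k + (coord1 x 1 - T) * coord1 y k.
  move=> /andP[T1T TT3]; set a := coord1 x 1; set b := coord1 y 1.
  have bT : b <= T by apply: le_trans T1T.
  have Ta : T <= a by apply: le_trans TT3 _; rewrite -T3E.
  have ab : 0 < a - b.
    rewrite subr_gt0; apply: le_lt_trans y1 _; apply: lt_le_trans x3; rewrite T3E.
    exact: lt_trans T12 T23.
  (* The parameter at which the segment has cost [T]. *)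
  pose s := (a - T) / (a - b).
  have sE k : coord1 ((1 - s) *: x + s *: y) k * (a - b) =
      (T - b) * coord1 x k + (a - T) * coord1 y k.
    by rewrite coord1D !coord1Z /s; field; rewrite gt_eqF.
  exists ((1 - s) *: x + s *: y); last first.
    split=> //; apply: (mulIf (lt0r_neq0 ab)); rewrite sE -/a -/b; ring.
  apply: seg; exists s => //=; rewrite in_itv /=; apply/andP; split.
    by apply: divr_ge0; [rewrite subr_ge0 | exact: ltW].
  by rewrite ler_pdivrMr// mul1r lerD2l lerN2.
have [|p1 N1 [E1 A1]] := on_seg T1; first by apply/andP; split; lra.
have [|p2 N2 [E2 A2]] := on_seg (T1 * tau); first by apply/andP; split; lra.
have [|p3 N3 [E3 A3]] := on_seg (T1 * tau * tau); first by apply/andP; split; lra.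
have NF p : Nb p -> F p by move=> [mu _ [Fp _]]; exact: interior_subset.
have lr : pt (2 * m + 2) <= 2.
  rewrite /pt ler_pdivrMr ?exprn_gt0// -exprS -rj -natrX ler_nat.
  by apply: leq_trans mr; rewrite leq_add2l.
have := LW_vertex_feasible r_gt0 t_gt1 lr; set v := LW_vertex _ _ => Fv.
have v1 : coord1 v 1 <= coord1 p2 1.
  by have [-> _] := LW_vertexE t (pt (2 * m + 2)) r_gt0; rewrite E2 -T2E.
(* [k] is the coordinate whose exponent rises before the corner and stays constant after it. *)
have [k kE [e [ve e1 e3]]] : exists2 k, k = (2 * j + 1)%N \/ k = (2 * j + 2)%N &
    exists e, [/\ coord1 v k = t `^ e * tau, coord1 p1 k <= 2 ^+ j * t `^ e &
                  coord1 p3 k <= 2 ^+ j * (t `^ e * tau)].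
  have [v2 v3] := LW_vertexE t (pt (2 * m + 2)) jr.
  have b1 : coord1 p1 1 <= t `^ pt (2 * m + 1) by rewrite E1.
  have b3 : coord1 p3 1 <= t `^ pt (2 * m + 3) by rewrite E3 T3E.
  have [c1 c2] := LW_coord_le r_gt0 t_gt1 (NF _ N1) b1 jr.
  have [c3 c4] := LW_coord_le r_gt0 t_gt1 (NF _ N3) b3 jr.
  have mj : (2 * m + 3 <= 2 ^ j.+1)%N by rewrite -rj.
  case: (expo_turn (R := R) mj) => -[q2 q3].
    exists (2 * j + 1)%N; first by left.
    exists (expo (pt (2 * m + 1)) j).1; split=> //.
      by rewrite v2 -powRDt -q2.
    by rewrite -powRDt -q3.
  exists (2 * j + 2)%N; first by right.
  exists (expo (pt (2 * m + 1)) j).2; split=> //.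
    by rewrite v3 -powRDt -q2.
  by rewrite -powRDt -q3.
have := LW_nbhd_coord_ge N2 Fv v1 kE.
rewrite ve => le.
have mix : (tau + 1) * coord1 p2 k = tau * coord1 p1 k + coord1 p3 k.
  have ab : coord1 x 1 - coord1 y 1 != 0.
    rewrite gt_eqF// subr_gt0; apply: le_lt_trans y1 _; apply: lt_le_trans x3.
    by rewrite T3E; exact: lt_trans T12 T23.
  move: (A1 k) (A2 k) (A3 k); rewrite -/T1.
  exact: interpolation_geometric ab.
have te0 : 0 < t `^ e by rewrite powR_gt0.
have P0 : 0 < 2 ^+ j :> R by rewrite exprn_gt0.
have C0 : 0 < 5 + 4 * nu by rewrite addr_gt0// mulr_gt0.
move: t_large; rewrite -/j -/d -/tau rj exprS.
exact: interpolation_turn_absurd tau1 te0 P0 C0 le mix e1 e3.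
Qed.

(** Each threshold is assigned the iteration that first brings the cost below it. Two thresholds
    sharing an iteration would give a segment of the kind excluded by [LW_segment_crossing], so the
    assignment is injective. *)
Lemma LW_path_length (x : nat -> 'cV[R]_(2 * r)) K N :
  short_step_iterates (LW_cost R r) F phi theta x ->
  (2 * N <= 2 ^ r)%N ->
  (forall m, (m < N)%N -> t `^ pt (2 * m + 1) < coord1 (x 0%N) 1) ->
  (forall m, (m < N)%N -> coord1 (x K) 1 <= t `^ pt (2 * m + 1)) ->
  (N <= K)%N.
Proof.
move=> xN Nr x0 xK.
have cross (m : 'I_N) : exists k : 'I_K,
    coord1 (x k.+1) 1 <= t `^ pt (2 * m + 1) < coord1 (x k) 1.
  have ex : exists k, coord1 (x k) 1 <= t `^ pt (2 * m + 1) by exists K; exact: xK.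
  case: (ex_minnP ex) => -[|k] kT kmin.
    by move: (x0 m (ltn_ord m)); rewrite ltNge kT.
  have kK : (k < K)%N by apply: kmin; exact: xK.
  exists (Ordinal kK); rewrite kT /= ltNge; apply/negP => /kmin.
  by rewrite ltnn.
pose f m : 'I_K := projT1 (cid (cross m)).
suff /leq_card : injective f by rewrite !card_ord.
have no (m m' : 'I_N) : f m = f m' -> (m < m')%N -> False.
  rewrite /f => fE mm'; have := projT2 (cid (cross m)); have := projT2 (cid (cross m')).
  rewrite -fE; move: (projT1 _) => k /= /andP[_ h1] /andP[h2 _].
  apply: (@LW_segment_crossing (x k) (x k.+1) m _ _ h2).
  - by move=> z zs; apply: xN; exists k.
  - by apply: leq_trans Nr; have := ltn_ord m'; lia.
  - apply: le_trans (ltW h1); apply: ler_powR; first exact: ltW.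
    by rewrite /pt ler_pM2r ?invr_gt0 ?exprn_gt0// ler_nat; lia.
move=> m m' fE; have [mm'|m'm|/val_inj//] := ltngtP (m : nat) m'.
  by case: (no _ _ fE mm').
by case: (no _ _ (esym fE) m'm).
Qed.

End LongWindingPath.

(** * Choice of [t0] and of the thresholds *)

Lemma ltr_scaled_mul (R : realFieldType) (c k nu M x y : R) : 0 < c -> 0 < nu ->
  1 <= k -> (c * nu)^-1 < M -> M <= y -> 0 < x -> x < c * k * nu * (x * y).
Proof.
move=> c0 nu0 k1 cM My x0; have cnu : 0 < c * nu by rewrite mulr_gt0.
have k0 : 0 < k by apply: lt_le_trans k1.
have -> : c * k * nu * (x * y) = x * (k * (c * nu * y)) by ring.
rewrite ltr_pMr//; apply: lt_le_trans (_ : 1 < c * nu * y) _.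
  by rewrite -ltr_pdivrMl// mulr1 (lt_le_trans cM).
rewrite ler_peMl// mulr_ge0 ?(ltW cnu)//.
by apply: le_trans My; apply: le_trans (ltW cM); rewrite invr_ge0 ltW.
Qed.

Unset Implicit Arguments.

Theorem corollary1 (R : realType) (r : nat) (theta nu : R)
    (r_ge1 : (1 <= r)%N) (theta_gt0 : 0 < theta) (theta_lt : theta < 1 / 2)
    (nu_gt0 : 0 < nu) :
  exists2 t0 : R, 1 < t0 & forall t : R, t0 <= t ->
    forall (phi : 'cV[R]_(2 * r) -> R) (x : nat -> 'cV[R]_(2 * r)) (K : nat),
      nu_self_concordant_barrier nu (LW_feasible t) phi ->
      short_step_iterates (LW_cost R r) (LW_feasible t) phi theta x ->
      320 * r%:R * nu * Num.sqrt t <= LW_gap t (x 0%N) ->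
      LW_gap t (x K) <= 1 / (180 * r%:R) ->
      (2 : R) ^ (r%:Z - 3) <= K%:R.
Proof.
have nu5 : 0 < 5 + 4 * nu by rewrite addr_gt0// mulr_gt0.
have C0 : 0 < 2 ^+ r * (5 + 4 * nu) by rewrite mulr_gt0// exprn_gt0.
have c0 : 0 < 320 :> R by rewrite ltr0n.
have nu320 : 0 < (320 * nu)^-1 by rewrite invr_gt0 (mulr_gt0 c0 nu_gt0).
have [M [M1 MC Mnu]] : exists M : R,
    [/\ 1 < M, 2 ^+ r * (5 + 4 * nu) < M & (320 * nu)^-1 < M].
  exists (1 + 2 ^+ r * (5 + 4 * nu) + (320 * nu)^-1).
  by move: C0 nu320; move: (_ * (_ + _)) (_^-1) => a b *; split; lra.
have M0 : 0 < M := lt_trans ltr01 M1.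
have r1 : 1 <= r%:R :> R by rewrite ler1n.
have r0 : 0 < r%:R :> R by rewrite ltr0n.
exists (M ^+ (2 ^ r)); first by rewrite exprn_egt1// expn_eq0.
move=> t tM phi x K nscb xN.
have t1 : 1 < t by apply: lt_le_trans tM; rewrite exprn_egt1// expn_eq0.
have t0 : 0 < t := lt_trans ltr01 t1.
rewrite /LW_gap LW_infE// !subr0 !LW_valueE// => x0 xK.
have powM d : 2 ^- r <= d -> M <= t `^ d.
  move=> rd; apply: (@le_trans _ _ (t `^ (2 ^- r))); last by rewrite ler_powR// ltW.
  have {1}-> : M = (M ^+ (2 ^ r)) `^ (2 ^- r).
    have n2 : 2 ^+ r != 0 :> R by rewrite expf_neq0// pnatr_eq0.
    by rewrite -(powR_mulrn _ (ltW M0)) -powRrM natrX (divff n2) (powRr1 (ltW M0)).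
  apply: ge0_ler_powR => //; rewrite ?nnegrE ?invr_ge0 ?exprn_ge0//; exact: ltW.
have pow1 l : 0 <= l -> 1 <= t `^ l.
  by move=> l0; rewrite -(powRr0 t) ler_powR// ltW.
have xK1 : coord1 (x K) 1 < 1.
  by apply: le_lt_trans xK _; rewrite ltr_pdivrMr ?mulr_gt0//; lra.
(* Splits [sqrt t] as [t]^ l * t [^ d], where the second factor exceeds [1 / (320 * nu)]. *)
have big l d : 0 <= l -> 2 ^- r <= d -> l + d = 2^-1 -> t `^ l < coord1 (x 0%N) 1.
  move=> l0 rd ld; apply: lt_le_trans x0; rewrite -powR12_sqrt ?(ltW t0)// -ld.
  rewrite powRD; last by rewrite (gt_eqF t0) implybT.
  exact: ltr_scaled_mul c0 nu_gt0 r1 Mnu (powM _ rd) (powR_gt0 _ t0).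
have rE : 2 ^- r <= 2^-1 :> R.
  rewrite lef_pV2 ?posrE ?exprn_gt0// -[leLHS]expr1 ler_weXn2l ?ler1n//.
have K1 : (1 <= K)%N.
  rewrite lt0n; apply/negP => /eqP K0; move: xK1; rewrite K0.
  by have := big 0 2^-1 (lexx _) rE (add0r _); rewrite powRr0; lra.
(* For [r < 3] the claimed bound is below 1, and one iteration is already known to be necessary. *)
have [r3|r3] := ltnP r 3.
  apply: (@le_trans _ _ 1); last by rewrite ler1n.
  have -> : r%:Z - 3 = - (3 - r)%N%:Z by rewrite -subzn ?opprB// ltnW.
  by rewrite -exprnN invf_le1 ?exprn_gt0// exprn_ege1// ler1n.
have -> : (r%:Z - 3 = (r - 3)%N%:Z) by rewrite subzn.
rewrite -exprnP -natrX ler_nat.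
have dE : 2 ^- r.-1 = 2 * 2 ^- r :> R.
  by rewrite -[in RHS](prednK r_ge1) exprS invfM mulrA divff ?mul1r.
have d0 : 0 < 2 ^- r :> R by rewrite invr_gt0 exprn_gt0.
(* Applied with [N = 2 ^ (r - 3)]: the odd nodes [2 * m + 1] with [m < N] have exponents at least
   [2 ^- r.-1] below [1 / 2], hence lie below the initial cost. *)
apply: (@LW_path_length R r t theta nu phi r_ge1 t1 nu_gt0 theta_lt nscb _ x).
- have Mt : M <= t `^ (2 ^- r.-1) by apply: powM; rewrite dE; lra.
  exact: lt_le_trans MC Mt.
- exact: xN.
- by rewrite -expnS leq_exp2l// -subSn// subSS leq_subr.
- move=> m mN; apply: (big _ (2^-1 - (2 * m + 1)%:R / 2 ^+ r.-1)).
  + by rewrite divr_ge0// exprn_ge0.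
  + have h : (2 * m + 2)%:R * 2 ^- r <= 4^-1 :> R.
      have NE : 2 ^+ (r - 3) * 2 * 2 ^- r = 4^-1 :> R.
        rewrite -[in X in _ * X](subnK r3) exprD; field.
        by rewrite expf_neq0.
      rewrite -NE ler_pM2r// -natrX -natrM ler_nat mulnC addnC -mulSn.
      by rewrite leq_mul2r.
    rewrite dE; move: h d0; rewrite addnS -natr1.
    move: (2 ^- r) (2 * m + 1)%:R => e n; lra.
  + by rewrite addrC subrK.
- move=> m _; apply: le_trans (ltW xK1) _; apply: pow1.
  by rewrite divr_ge0// exprn_ge0.
Qed.
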